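(* Let $\mu$ be a Borel probability measure on $\mathbb{R}^p$ whose support is compact with nonempty interior, let $n\ge1$, let $X_1,\dots,X_n$ be i.i.d. with law $\mu$, let $\mu_n=\frac1n\sum_{i=1}^n\delta_{X_i}$, and let $d\in\mathbb{N}$. Then for every $\alpha>0$, with probability at least $1-\alpha$, for all $x\in\mathbb{R}^p$, $$\big|\Lambda_{\mu,d}(x)-\Lambda_{\mu_n,d}(x)\big|\le\Lambda_{\mu,d}(x)\,\max\left(\sqrt{\frac{16m}{3n}\log\frac{s(d)}{\alpha}},\ \frac{16m}{3n}\log\frac{s(d)}{\alpha}\right),$$ where $m=\sup_{x\in\operatorname{supp}\mu}\kappa_{\mu,d}(x,x)$.
   Context: $\Pi_d^p$ is the space of real polynomials in $p$ variables of degree at most $d$, and $s(d)=\dim\Pi_d^p=\binom{d+p}{d}$. $\kappa_{\mu,d}$ (Christoffel–Darboux kernel) is the reproducing kernel of $\Pi_d^p$ equipped with $\langle P,Q\rangle_\mu=\int PQ\,d\mu$, i.e. $\kappa_{\mu,d}(x,y)=\sum_{j=1}^{s(d)}P_j(x)P_j(y)$ for any orthonormal basis $(P_j)$. For a finite Borel measure $\nu$ with finite moments, the Christoffel function is $\Lambda_{\nu,d}(z)=\min\{\int P^2\,d\nu:P\in\Pi_d^p,\ P(z)=1\}$, which equals $1/\kappa_{\nu,d}(z,z)$ whenever $\langle\cdot,\cdot\rangle_\nu$ is an inner product on $\Pi_d^p$. *)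

(* Defs.v *)
(* The notations of multinomials' mpoly.v clash with those of MathComp-Analysis,
   hence the filtered import. *)
From HB Require Import structures.
From mathcomp Require Import all_boot all_order all_algebra.
From mathcomp Require Import (canonicals, coercions) mpoly.
From mathcomp Require Import all_classical all_reals all_analysis.

Set Implicit Arguments.
Unset Strict Implicit.
Unset Printing Implicit Defensive.

Import Order.TTheory GRing.Theory Num.Theory.
Import numFieldNormedType.Exports.

Local Open Scope classical_set_scope.
Local Open Scope ring_scope.

(* R^p as a measurable space, with its Borel sigma-algebra. *)
Notation borelRn R p := (g_sigma_algebraType (@open 'rV[R]_p)).

Definition mvpoly (R : realType) (p : nat) := mpoly.mpoly p R.

Definition pval (R : realType) (p : nat) (P : mvpoly R p) (x : 'rV[R]_p) : R :=
  mpoly.meval (fun i : 'I_p => x ord0 i) P.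

(* [msize] is the total degree plus one, and is 0 for the zero polynomial. *)
Definition Pi (R : realType) (p d : nat) : set (mvpoly R p) :=
  [set P | (mpoly.msize P <= d.+1)%N].

(* The dimension of [Pi R p d]. *)
Definition sdim (p d : nat) : nat := 'C(d + p, d).

Definition measure_support (R : realType) (p : nat)
    (mu : set (borelRn R p) -> \bar R) : set 'rV[R]_p :=
  [set x | forall U : set 'rV[R]_p, open U -> U x -> (0 < mu U)%E].

(* [Rintegral] is the real-valued integral, with junk value 0 for a divergent
   integral of a nonnegative function; polynomials are integrable for the
   measures considered (compactly supported, or empirical). *)
Definition poly_inner (R : realType) (p : nat)
    (nu : {measure set (borelRn R p) -> \bar R}) (P Q : mvpoly R p) : R :=
  Rintegral nu setT (fun x : borelRn R p => pval P x * pval Q x).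

(* [K] is the reproducing kernel of [Pi R p d] with inner product
   [poly_inner mu]: K(x, .) lies in the space and represents evaluation at x. *)
Definition reproducing_kernel (R : realType) (p : nat)
    (mu : {measure set (borelRn R p) -> \bar R}) (d : nat)
    (K : 'rV[R]_p -> 'rV[R]_p -> R) : Prop :=
  forall x : 'rV[R]_p, exists Q : mvpoly R p,
    [/\ Pi d Q, K x = pval Q &
        forall P : mvpoly R p, Pi d P -> poly_inner mu P Q = pval P x].

(* There is exactly one such kernel when [poly_inner mu] is an inner product on
   [Pi R p d]; [xget] selects it. *)
Definition CD_kernel (R : realType) (p : nat)
    (mu : {measure set (borelRn R p) -> \bar R}) (d : nat) :
    'rV[R]_p -> 'rV[R]_p -> R :=
  xget (fun _ _ => 0) [set K | reproducing_kernel mu d K].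

(* The infimum is over a nonempty set of nonnegative reals (it contains the
   value at P = 1), and is attained since a nonnegative quadratic form attains
   its minimum on an affine subspace. *)
Definition christoffel (R : realType) (p : nat)
    (nu : {measure set (borelRn R p) -> \bar R}) (d : nat) (z : 'rV[R]_p) : R :=
  inf [set poly_inner nu P P | P in [set P | Pi d P /\ pval P z = 1]].

Section empirical_measure.
Context (R : realType) d (T : measurableType d) (n : nat).
Local Open Scope ereal_scope.

Definition empirical_measure (x : 'I_n -> T) (A : set T) : \bar R :=
  (n%:R^-1)%R%:E * \sum_(i < n) \d_(x i) A.

Variable x : 'I_n -> T.

Let dirac_seq (k : nat) : {measure set T -> \bar R} :=
  if insub k is Some i then (\d_(x i) : {measure set T -> \bar R}) else mzero.

Let empirical_measureE :
  empirical_measure x = mscale ((n%:R^-1)%:nng : {nonneg R})%R (msum dirac_seq n).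
Proof.
apply/funext => A; rewrite /empirical_measure /mscale /msum /=; congr (_ * _).
by apply: eq_bigr => i _; rewrite /dirac_seq valK.
Qed.

Let empirical_measure0 : empirical_measure x set0 = 0.
Proof. by rewrite empirical_measureE measure0. Qed.

Let empirical_measure_ge0 A : 0 <= empirical_measure x A.
Proof. by rewrite empirical_measureE measure_ge0. Qed.

Let empirical_measure_sigma_additive :
  semi_sigma_additive (empirical_measure x).
Proof.
rewrite empirical_measureE; exact: measure_semi_sigma_additive.
Qed.

HB.instance Definition _ := isMeasure.Build _ _ _ (empirical_measure x)
  empirical_measure0 empirical_measure_ge0 empirical_measure_sigma_additive.

End empirical_measure.

(* Mutual independence of finitely many random variables with values in T. *)
Definition mutually_independent (R : realType) (dO dT : measure_display)
    (Omega : measurableType dO) (T : measurableType dT)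
    (Pr : probability Omega R) (n : nat) (X : 'I_n -> {RV Pr >-> T}) : Prop :=
  forall (J : {set 'I_n}) (A : 'I_n -> set T),
    (forall i, measurable (A i)) ->
    Pr (\bigcap_(i in [set` J]) (X i @^-1` A i)) =
    (\prod_(i in J) Pr (X i @^-1` A i))%E.

(* The law is compared on measurable sets only: the value of a measure
   elsewhere is meaningless. *)
Definition has_law (R : realType) (dO dT : measure_display)
    (Omega : measurableType dO) (T : measurableType dT)
    (Pr : probability Omega R) (X : {RV Pr >-> T}) (mu : probability T R) :
    Prop :=
  forall A : set T, measurable A -> distribution Pr X A = mu A.

(* Main.v *)
Require Import Defs.
From HB Require Import structures.
From mathcomp Require Import all_boot all_order all_algebra.
From mathcomp Require Import (canonicals, coercions) mpoly.
From mathcomp Require Import all_classical all_reals all_analysis.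
From mathcomp Require Import measurable_realfun.
From mathcomp Require Import ring lra.

(** Let [v] be the vector of an orthonormal basis of polynomials, so that
    [E[v(X) v(X)^T] = I] and [|v|^2 <= m] on the support.  It suffices to show
    that, outside an event of small probability, all eigenvalues of
    [S = sum_i v(X_i) v(X_i)^T] lie in [n (1 - eps), n (1 + eps)]: then the two
    quadratic forms whose minima define the Christoffel functions compare.

    The extreme eigenvalues are controlled by Markov's inequality for
    [tr (I + (theta/N) S)^N] with [theta] of either sign and [N] a large integer,
    a polynomial substitute for the matrix Laplace transform.  For psd [P] the
    moments [m_k = v P^k v^T] are log-convex, hence [m_a m_b <= m_0 m_(a+b)];
    this bounds the increment of [tr P^N] under a rank-one update of [P] by a
    multiple of [v P^N v^T], whose mean is the mean of [tr P^N] by independence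
    and isotropy.  This replaces the Golden-Thompson inequality, and since the
    resulting exponents have some slack, a finite [N] is enough. *)

Set Implicit Arguments.
Unset Strict Implicit.
Unset Printing Implicit Defensive.

Import Order.TTheory GRing.Theory Num.Theory.
Import numFieldNormedType.Exports.

Local Open Scope classical_set_scope.
Local Open Scope ring_scope.

(** * Powers of positive semidefinite matrices under rank-one updates *)

(** The bound involves L = log (s(d) / alpha) and not log (2 s(d) / alpha), although two tails are
    added: each tail must therefore decay strictly faster than exp (- L). The limiting exponents
    16/9 L and 8/3 L, lowered to 7/4 L and 5/2 L for a finite N, leave enough room for the union as
    soon as s(d) >= 2; when s(d) = 1 there are only constants and nothing is random. The maximum of
    sqrt c and c is the solution eps of eps min (eps, 1) = c, so a single equation covers the
    square-root and the linear regime. Eigenvalues themselves never occur. If the quotient u P u^T /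
    |u|^2 is at least lambda >= 0, log-convexity of the moments gives u P^N u^T >= lambda^N |u|^2,
    and a psd form is at most |u|^2 times its trace; hence a trace below lambda^N excludes such a u.
    For negative theta the pencil lies below 1, but this compares moments only from an even index to
    the next one, which forces an odd power. *)

Section log_convex.
Context (R : realFieldType) (m : nat -> R).
Hypothesis m_ge0 : forall k, 0 <= m k.
Hypothesis m_lc : forall k, m k.+1 ^+ 2 <= m k * m k.+2.

(** The ratios m (k+1) / m k are nondecreasing. The product form avoids dividing by a term that may
    vanish, in which case the next term vanishes too. *)
Lemma log_convex_shift a b : (a <= b)%N -> m a.+1 * m b <= m a * m b.+1.
Proof.
move=> /subnK <-; move: (b - a)%N => {b}; elim=> [|k IHk].
  by rewrite add0n mulrC.
rewrite addSn; have := m_ge0 (k + a); rewrite le_eqVlt => /orP[/eqP m0|mp].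
  have := m_lc (k + a); rewrite -m0 mul0r => h.
  have /eqP : m (k + a).+1 ^+ 2 = 0 by apply/le_anti; rewrite h sqr_ge0.
  rewrite sqrf_eq0 => /eqP ->; rewrite mulr0.
  by rewrite mulr_ge0.
rewrite -(ler_pM2r mp).
apply: (@le_trans _ _ (m a * m (k + a).+1 * m (k + a).+1)).
  by rewrite mulrAC ler_wpM2r.
rewrite -!mulrA ler_wpM2l // -expr2 (le_trans (m_lc _)) //.
by rewrite mulrC.
Qed.

(** Each use of [log_convex_shift] moves one unit from the smaller index to the larger one. *)
Lemma log_convex_mul a b : m a * m b <= m 0 * m (a + b).
Proof.
wlog ab : a b / (a <= b)%N.
  by case/orP: (leq_total a b) => h H; [|rewrite mulrC addnC]; exact: H.
elim: a b ab => [|a IHa] b ab; first by rewrite add0n.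
rewrite addSnnS (le_trans (log_convex_shift (ltnW ab))) // IHa //.
by rewrite (leq_trans _ (leqnSn b)) // ltnW.
Qed.

Lemma log_convex_eq0 k : m 0 = 0 -> m k.+1 = 0.
Proof.
move=> m0; elim: k => [|k IHk]; apply/eqP; rewrite -sqrf_eq0 -[_ == _]andbT;
  apply/andP; split=> //; apply/eqP/le_anti; rewrite sqr_ge0 andbT;
  by rewrite (le_trans (m_lc _)) // ?m0 ?IHk mul0r.
Qed.

(** The first ratio of consecutive terms is the smallest. *)
Lemma log_convex_growth rho k : rho * m 0 <= m 1 -> rho * m k <= m k.+1.
Proof.
move=> h; have := m_ge0 0; rewrite le_eqVlt => /orP[/eqP m0|mp].
  case: k => [|k] //; rewrite !log_convex_eq0 ?mulr0 //.
have := log_convex_mul 1 k; rewrite add1n => h1.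
rewrite -(ler_pM2l mp) (le_trans _ h1) //.
by rewrite mulrA ler_wpM2r // mulrC.
Qed.

Lemma log_convex_geom rho k : 0 <= rho -> rho * m 0 <= m 1 -> rho ^+ k * m 0 <= m k.
Proof.
move=> rho0 h; elim: k => [|k IHk]; first by rewrite expr0 mul1r.
by rewrite exprS -mulrA (le_trans (ler_wpM2l _ IHk)) // log_convex_growth.
Qed.

End log_convex.

(** * Quadratic forms and powers of positive semidefinite matrices *)

Section psd_matrices.
Context (R : realFieldType) (n : nat).
Implicit Types (A B P H : 'M[R]_n.+1) (u v w : 'rV[R]_n.+1).

Definition bform A u w : R := (u *m A *m w^T) 0 0.

Definition psd A := A^T = A /\ forall u, 0 <= bform A u u.

Definition rank1 v : 'M[R]_n.+1 := v^T *m v.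

Lemma bformDm A B u w : bform (A + B) u w = bform A u w + bform B u w.
Proof. by rewrite /bform mulmxDr mulmxDl mxE. Qed.

Lemma bformZm c A u w : bform (c *: A) u w = c * bform A u w.
Proof. by rewrite /bform -scalemxAr -scalemxAl mxE. Qed.

Lemma bform_sumr (I : Type) (s : seq I) (F : I -> 'M[R]_n.+1) u w :
  bform (\sum_(i <- s) F i) u w = \sum_(i <- s) bform (F i) u w.
Proof. by rewrite /bform mulmx_sumr mulmx_suml summxE. Qed.

Lemma bformC A u w : A^T = A -> bform A u w = bform A w u.
Proof.
move=> sA; rewrite /bform.
by rewrite -[in LHS](trmxK (u *m A *m w^T)) mxE !trmx_mul trmxK sA mulmxA.
Qed.

Lemma bform_comb A a b u w : A^T = A ->
  bform A (a *: u + b *: w) (a *: u + b *: w) =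
  a ^+ 2 * bform A u u + 2 * a * b * bform A u w + b ^+ 2 * bform A w w.
Proof.
move=> sA; have := bformC u w sA; rewrite /bform.
have trZ (c : R) (x : 'rV[R]_n.+1) : (c *: x)^T = c *: x^T.
  by apply/matrixP => i j; rewrite !mxE.
have trD (x y : 'rV[R]_n.+1) : (x + y)^T = x^T + y^T.
  by apply/matrixP => i j; rewrite !mxE.
rewrite trD !trZ !mulmxDl !mulmxDr -!scalemxAl -!scalemxAr !mxE.
by move=> ->; ring.
Qed.

Lemma bform_CS A u w : psd A -> bform A u w ^+ 2 <= bform A u u * bform A w w.
Proof.
move=> [sA pA]; have q a b := bform_comb a b u w sA.
have {}q a b : 0 <= a ^+ 2 * bform A u u + 2 * a * b * bform A u w
                    + b ^+ 2 * bform A w w by rewrite -q.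
move: (pA u) (pA w) q.
move: (bform A u u) (bform A u w) (bform A w w) => a b c a0 + q.
rewrite le_eqVlt => /orP[/eqP c0|c0].
  (* With c = 0, the form at these coefficients equals - b ^ 2, which forces b = 0. *)
  have := q b (- (a + 1) / 2); rewrite -c0 !mulr0 addr0 => h.
  suff : - b ^+ 2 >= 0 by rewrite oppr_ge0.
  suff -> : - b ^+ 2 = b ^+ 2 * a + 2 * b * (- (a + 1) / 2) * b by [].
  by field.
have := q c (- b).
suff -> : c ^+ 2 * a + 2 * c * - b * b + (- b) ^+ 2 * c =
          c * (a * c - b ^+ 2) by rewrite pmulr_rge0 // subr_ge0.
by ring.
Qed.

Lemma bform_conj A B u w : bform (A^T * B * A) u w = bform B (u *m A^T) (w *m A^T).
Proof. by rewrite /bform -!mulmxE trmx_mul trmxK !mulmxA. Qed.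

Lemma bform_rank1 v u w : bform (rank1 v) u w = bform 1 u v * bform 1 v w.
Proof.
by rewrite /bform /rank1 !mulmx1 mulmxA -mulmxA mxE big_ord1.
Qed.

Lemma bform1_ge0 u : 0 <= bform 1 u u.
Proof.
rewrite /bform mulmx1 mxE; apply: sumr_ge0 => i _; by rewrite !mxE -expr2 sqr_ge0.
Qed.

Lemma psd1 : psd 1.
Proof. by split; [exact: trmx1 | exact: bform1_ge0]. Qed.

Lemma trmxX A k : (A ^+ k)^T = A^T ^+ k.
Proof.
by elim: k => [|k IHk]; [exact: trmx1 | rewrite exprSr -mulmxE trmx_mul IHk mulmxE -exprS].
Qed.

Lemma symX A k : A^T = A -> (A ^+ k)^T = A ^+ k.
Proof. by rewrite trmxX => ->. Qed.

Lemma bformX2 A k u w : A^T = A -> bform (A ^+ k.+2) u w = bform (A ^+ k) (u *m A) (w *m A).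
Proof. by move=> sA; rewrite exprS exprSr mulrA -{1}sA bform_conj sA. Qed.

Lemma psdX A k : psd A -> psd (A ^+ k).
Proof.
move=> [sA pA]; split; first exact: symX.
(* Two consecutive powers are treated together because [bformX2] lowers the exponent by two. *)
have H k' : (forall u, 0 <= bform (A ^+ k') u u) /\ (forall u, 0 <= bform (A ^+ k'.+1) u u).
  elim: k' => [|k' [IH1 IH2]]; first by split=> u; rewrite ?expr0 ?bform1_ge0.
  by split=> // u; rewrite bformX2.
by case: (H k).
Qed.

Definition moment P v k := bform (P ^+ k) v v.

Lemma moment_ge0 P v k : psd P -> 0 <= moment P v k.
Proof. by move=> /(psdX k)[_]; apply. Qed.

(** Cauchy-Schwarz for the form of P^k at the vectors v and v P. *)
Lemma moment_lc P v k : psd P ->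
  moment P v k.+1 ^+ 2 <= moment P v k * moment P v k.+2.
Proof.
move=> pP; have [sP _] := pP; rewrite /moment bformX2 //.
suff -> : bform (P ^+ k.+1) v v = bform (P ^+ k) v (v *m P).
  by apply: bform_CS; exact: psdX.
by rewrite /bform exprSr -mulmxE trmx_mul sP !mulmxA.
Qed.

Lemma bformE A u w : bform A u w = \sum_i \sum_j A i j * (u 0 i * w 0 j).
Proof.
rewrite /bform !mxE; under eq_bigr do rewrite !mxE mulr_suml.
by rewrite exchange_big /=; apply: eq_bigr => i _; apply: eq_bigr => j _; ring.
Qed.

Lemma bform1E u : bform 1 u u = \sum_i u 0 i ^+ 2.
Proof. by rewrite /bform mulmx1 mxE; apply: eq_bigr => i _; rewrite mxE expr2. Qed.

Lemma bform1_rank1_le u v : bform (rank1 v) u u <= bform 1 u u * bform 1 v v.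
Proof.
rewrite bform_rank1 (bformC v u) ?trmx1 // -expr2; apply: bform_CS; exact: psd1.
Qed.

Lemma bform_rank1_ge0 u v : 0 <= bform (rank1 v) u u.
Proof. by rewrite bform_rank1 (bformC v u) ?trmx1 // -expr2 sqr_ge0. Qed.

Lemma bform_delta A i j : bform A (delta_mx 0 i) (delta_mx 0 j) = A i j.
Proof. by rewrite /bform -rowE trmx_delta -colE !mxE. Qed.

Lemma trace_psd_ge0 P : psd P -> 0 <= \tr P.
Proof. by move=> [_ pP]; apply: sumr_ge0 => i _; rewrite -bform_delta. Qed.

(** The trace dominates the largest eigenvalue. Entrywise, P i j ^ 2 <= P i i P j j, so AM-GM bounds
    u i u j P i j by half of u i ^ 2 P j j + u j ^ 2 P i i, and these bounds sum to |u|^2 tr P. *)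
Lemma trace_psd_ge P u : psd P -> bform P u u <= bform 1 u u * \tr P.
Proof.
move=> pP.
have Pii i : 0 <= P i i by rewrite -bform_delta; case: pP.
have PCS i j : P i j ^+ 2 <= P i i * P j j by rewrite -!bform_delta bform_CS.
have AMGM (a b c d q : R) : 0 <= c -> 0 <= d -> q ^+ 2 <= c * d ->
    2 * (a * b * q) <= a ^+ 2 * d + b ^+ 2 * c.
  move=> c0 d0 qcd.
  suff h : (a * b * q) ^+ 2 *+ 4 <= (a ^+ 2 * d + b ^+ 2 * c) ^+ 2.
    have sp : 0 <= a ^+ 2 * d + b ^+ 2 * c by rewrite addr_ge0 // mulr_ge0 // sqr_ge0.
    rewrite leNgt; apply/negP => lt; move: h; apply/negP; rewrite -ltNge.
    set s := _ + _ in sp lt *; set t := a * b * q in lt *.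
    by rewrite -mulr_natl; nra.
  apply: (@le_trans _ _ ((a * b) ^+ 2 * (c * d) *+ 4)).
    by rewrite lerMn2r /= exprMn ler_wpM2l // sqr_ge0.
  rewrite -subr_ge0.
  have -> : (a ^+ 2 * d + b ^+ 2 * c) ^+ 2 - (a * b) ^+ 2 * (c * d) *+ 4 =
    (a ^+ 2 * d - b ^+ 2 * c) ^+ 2 by rewrite -mulr_natl; ring.
  exact: sqr_ge0.
rewrite -(@ler_pM2l _ 2) // bformE bform1E /mxtrace.
apply: (@le_trans _ _ (\sum_i \sum_j (u 0 i ^+ 2 * P j j + u 0 j ^+ 2 * P i i))).
  rewrite mulr_sumr; apply: ler_sum => i _; rewrite mulr_sumr; apply: ler_sum => j _.
  by rewrite [P i j * _]mulrC; apply: AMGM.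
rewrite mulr_natl mulr2n mulr_suml -big_split /=.
under eq_bigr do rewrite big_split /= -mulr_sumr -mulr_suml.
rewrite !big_split /= lerD2l -mulr_sumr mulr_suml //.
Qed.

Lemma rank1_tr v : (rank1 v)^T = rank1 v.
Proof. by rewrite /rank1 trmx_mul trmxK. Qed.

Lemma bform_mulrank1 A B v u w :
  bform (A * rank1 v * B) u w = bform A u v * bform B v w.
Proof.
rewrite /bform /rank1 -!mulmxE.
have -> : u *m (A *m (v^T *m v) *m B) *m w^T = (u *m A *m v^T) *m (v *m B *m w^T).
  by rewrite !mulmxA.
by rewrite [LHS]mxE big_ord1.
Qed.

Lemma trace_mulrank1 A B v : \tr (A * rank1 v * B) = bform (B * A) v v.
Proof.
rewrite /bform /rank1 -!mulmxE.
rewrite mxtrace_mulC -trace_mx11 !mulmxA mxtrace_mulC !mulmxA mxtrace_mulC.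
by rewrite !mulmxA.
Qed.

(** * Increment of the trace of a power *)

Section rank1_update.
Variables (P : 'M[R]_n.+1) (v : 'rV[R]_n.+1) (e : R).
Hypothesis pP : psd P.
Let H := P + e *: rank1 v.
Let mo := moment P v.
(** The mixed moments v P^a H^b v^T interpolate between the moments of P and those of H; expanding
    one factor H = P + e v^T v lowers b. *)
Let x b a := bform (P ^+ a * H ^+ b) v v.

Lemma rank1_update_sym : H^T = H.
Proof.
have [sP _] := pP; apply/matrixP => i j.
have := congr1 (fun M : 'M[R]_n.+1 => M i j) sP.
have := congr1 (fun M : 'M[R]_n.+1 => M i j) (rank1_tr v).
by rewrite [H]lock !mxE -lock !mxE => -> ->.
Qed.

Let x0 a : x 0 a = mo a.
Proof. by rewrite /x expr0 mulr1. Qed.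

Let xS b a : x b.+1 a = x b a.+1 + e * mo a * x b 0.
Proof.
rewrite /x exprS mulrA /H mulrDr mulrDl bformDm -exprSr; congr (_ + _).
by rewrite -scalerAr -scalerAl bformZm bform_mulrank1 expr0 mul1r mulrA.
Qed.

(** Telescoping along P^(N - k) H^k: exchanging one P for an H costs e times the trace of a rank-one
    product. *)
Let trE N : \tr (H ^+ N) = \tr (P ^+ N) + e * \sum_(b < N) bform (H ^+ b * P ^+ (N - b.+1)) v v.
Proof.
have step b a : \tr (P ^+ a * H ^+ b.+1) =
    \tr (P ^+ a.+1 * H ^+ b) + e * bform (H ^+ b * P ^+ a) v v.
  rewrite exprS mulrA {1}/H mulrDr mulrDl mxtraceD -exprSr; congr (_ + _).
  by rewrite -scalerAr -scalerAl mxtraceZ trace_mulrank1.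
suff tele k : (k <= N)%N -> \tr (P ^+ (N - k) * H ^+ k) =
    \tr (P ^+ N) + e * \sum_(b < k) bform (H ^+ b * P ^+ (N - b.+1)) v v.
  by have := tele N (leqnn N); rewrite subnn expr0 mul1r.
elim: k => [|k IHk] kN; first by rewrite subn0 expr0 mulr1 big_ord0 mulr0 addr0.
by rewrite step -subSn // subSS IHk ?(ltnW kN) // big_ord_recr /= mulrDr addrA.
Qed.

Let trxE N : \tr (H ^+ N) = \tr (P ^+ N) + e * \sum_(b < N) x b (N - b.+1).
Proof.
rewrite trE; congr (_ + _ * _); apply: eq_bigr => b _.
rewrite /x /bform -[LHS]trace_mx11 -[RHS]trace_mx11 -mxtrace_tr.
have [sP _] := pP.
by rewrite -!mulmxE !trmx_mul !trmxK !trmxX rank1_update_sym sP !mulmxA.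
Qed.

Section positive_update.
Variable y : R.
Hypothesis e_ge0 : 0 <= e.
Hypothesis vy : bform 1 v v <= y.
Hypothesis P_ge1 : bform 1 v v <= bform P v v.

Let mo0 : mo 0 = bform 1 v v. Proof. by rewrite /mo /moment expr0. Qed.

Let mo_incr k : mo k <= mo k.+1.
Proof.
rewrite -[X in X <= _]mul1r; apply: log_convex_growth => [j|j|].
- exact: moment_ge0.
- exact: moment_lc.
- by rewrite mul1r /mo /moment expr0 expr1.
Qed.

(** The correction in [xS] is controlled by m_a m_b <= m_0 m_(a+b) <= y m_(a+b+1), so each of the b
    expansions costs a factor 1 + e y. *)
Let x_le b a : x b a <= (1 + e * y) ^+ b * mo (b + a).
Proof.
have y0 : 0 <= y by rewrite (le_trans (bform1_ge0 v)).
have ey : 0 <= 1 + e * y by rewrite addr_ge0 // mulr_ge0.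
elim: b a => [|b IHb] a; first by rewrite x0 expr0 mul1r.
rewrite xS exprSr -[leRHS]mulrA mulrDl mul1r mulrDr lerD //.
  by rewrite (le_trans (IHb _)) // addSnnS.
apply: (@le_trans _ _ (e * mo a * ((1 + e * y) ^+ b * mo b))).
  rewrite ler_wpM2l //; first by rewrite mulr_ge0 // moment_ge0.
  by have := IHb 0; rewrite addn0.
rewrite mulrCA ler_wpM2l ?exprn_ge0 // -!mulrA ler_wpM2l //.
rewrite mulrC (le_trans (log_convex_mul _ _ _ _)) //.
- by move=> k; exact: moment_ge0.
- by move=> k; exact: moment_lc.
by rewrite ler_pM ?moment_ge0.
Qed.

(** For y > 0, e times the geometric sum is ((1 + e y)^N - 1) / y. With e = theta / N it is at most
    (exp (theta y) - 1) / y, the coefficient of the matrix Chernoff bound. *)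
Lemma trace_rank1_addX_le N :
  \tr (H ^+ N) <= \tr (P ^+ N) + e * (\sum_(b < N) (1 + e * y) ^+ b) * moment P v N.
Proof.
have y0 : 0 <= y by rewrite (le_trans (bform1_ge0 v)).
rewrite trxE lerD2l -mulrA ler_wpM2l // mulr_suml; apply: ler_sum => b _.
rewrite (le_trans (x_le _ _)) // ler_wpM2l ?exprn_ge0 ?addr_ge0 ?mulr_ge0 //.
by case: N b => [[]//|N b]; rewrite subSS subnKC ?mo_incr // -ltnS.
Qed.
End positive_update.

Section negative_update.
Variable y rho : R.
Hypothesis e_le0 : e <= 0.
Hypothesis vy : bform 1 v v <= y.
Hypothesis P_ge : rho * bform 1 v v <= bform P v v.
Hypothesis rho_gt0 : 0 < rho.
Hypothesis P_le1 : forall u, bform P u u <= bform 1 u u.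
Hypothesis pH : psd H.

Let mo0 : mo 0 = bform 1 v v. Proof. by rewrite /mo /moment expr0. Qed.

Let mo_rho k : rho * mo k <= mo k.+1.
Proof.
apply: log_convex_growth => [j|j|]; [exact: moment_ge0|exact: moment_lc|].
by rewrite /mo /moment expr0 expr1.
Qed.

(** The inequality P <= 1 is applied to the vector v P^k, hence the restriction to an even index. *)
Let mo_decr k : mo k.*2.+1 <= mo k.*2.
Proof.
have [sP _] := pP; have sPk := symX k sP.
have E A : bform (P ^+ k * A * P ^+ k) v v = bform A (v *m P ^+ k) (v *m P ^+ k).
  by rewrite -{1}sPk bform_conj sPk.
have := P_le1 (v *m P ^+ k); rewrite -!E /mo /moment mulr1 -exprD addnn.
by rewrite -exprSr -exprD addSn addnn.
Qed.

Let x_le b a : x b a <= mo (b + a).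
Proof.
elim: b a => [|b IHb] a; first by rewrite x0.
rewrite xS addSnnS (le_trans _ (IHb _)) // gerDl -mulrA mulr_le0_ge0 //.
rewrite mulr_ge0 //; first exact: moment_ge0.
by rewrite /x expr0 mul1r; case: (psdX b pH) => _; apply.
Qed.

(** By [x_le] and log-convexity each of the b expansions loses at most |e| y times the moment of
    index a + b - 1; the losses add up instead of multiplying. *)
Let x_ge b a : mo (b + a) + e * b%:R * y * mo (b + a).-1 <= x b a.
Proof.
elim: b a => [|b IHb] a; first by rewrite mulr0 !mul0r addr0 x0.
rewrite xS; have := IHb a.+1; rewrite addnS addSn /= => h.
apply: le_trans (lerD h (lexx _)).
rewrite -addrA lerD2l -natr1 mulrDr mulr1 !mulrDl lerD2l -!mulrA.
rewrite ler_wnM2l // (@le_trans _ _ (mo a * mo b)) //.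
  by rewrite ler_wpM2l ?moment_ge0 // (le_trans (x_le _ _)) // addn0.
rewrite mulrC (le_trans (log_convex_mul _ _ _ _)) //.
- by move=> k; exact: moment_ge0.
- by move=> k; exact: moment_lc.
by rewrite ler_wpM2r ?moment_ge0 // -/mo mo0.
Qed.

(** The second-order term th ^ 2 y / 2 comes from summing the linear losses over b < M, where the
    sum of the b is at most M ^ 2 / 2. The factor 1 / rho is the price of passing from the moment 2N
    - 1 to the moment 2N. *)
Lemma trace_rank1_subX_le N (th := - (e * N.*2.+1%:R)) : (0 < N)%N ->
  th * y <= 2 * rho ->
  \tr (H ^+ N.*2.+1) <= \tr (P ^+ N.*2.+1) -
     (th - th ^+ 2 * y / (2 * rho)) * moment P v N.*2.+1.
Proof.
move=> N0 th_small; set M := N.*2.+1.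
have y0 : 0 <= y by rewrite (le_trans (bform1_ge0 v)).
have th0 : 0 <= th by rewrite oppr_ge0 mulr_le0_ge0.
have sumx : M%:R * mo N.*2 + e * y * (M%:R ^+ 2 / 2) * mo N.*2.-1 <=
            \sum_(b < M) x b (M - b.+1).
  apply: (@le_trans _ _ (\sum_(b < M) (mo N.*2 + e * b%:R * y * mo N.*2.-1))).
    have -> : \sum_(b < M) (mo N.*2 + e * b%:R * y * mo N.*2.-1) =
        M%:R * mo N.*2 + e * y * (\sum_(b < M) b%:R) * mo N.*2.-1.
      rewrite big_split /= sumr_const card_ord -[mo N.*2 *+ M]mulr_natl; congr (_ + _).
      by rewrite mulr_sumr mulr_suml; apply: eq_bigr => b _; ring.
    rewrite lerD2l ler_wpM2r ?moment_ge0 // ler_wnM2l ?mulr_le0_ge0 //.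
    rewrite -natr_sum -(big_mkord xpredT (fun i => i)) bin2_sum.
    rewrite ler_pdivlMr // -natrX -natrM ler_nat.
    by rewrite mulnC -mul_bin_diag bin1 -mulnn leq_mul2l leq_pred orbT.
  apply: ler_sum => b _; rewrite (le_trans _ (x_ge _ _)) //.
  by rewrite /M subSS subnKC // -ltnS.
rewrite trxE -lerBlDl addrAC subrr add0r.
apply: (@le_trans _ _ (e * (M%:R * mo N.*2 + e * y * (M%:R ^+ 2 / 2) * mo N.*2.-1))).
  by rewrite ler_wnM2l.
have -> : e * (M%:R * mo N.*2 + e * y * (M%:R ^+ 2 / 2) * mo N.*2.-1) =
   - (th * mo N.*2 - th ^+ 2 * y / 2 * mo N.*2.-1).
  by rewrite (_ : th = - (e * M%:R)) //; move: M%:R => c; field.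
rewrite lerN2.
(* The smallness of th y makes this coefficient nonnegative, so that the moment 2N may be replaced
   by the smaller moment 2N + 1. *)
have g0 : 0 <= th - th ^+ 2 * y / (2 * rho).
  have -> : th - th ^+ 2 * y / (2 * rho) = th * (2 * rho - th * y) / (2 * rho).
    by field; rewrite gt_eqF.
  by rewrite divr_ge0 ?mulr_ge0 ?(ltW rho_gt0) ?subr_ge0 ?ler0n.
apply: (@le_trans _ _ ((th - th ^+ 2 * y / (2 * rho)) * mo N.*2)).
  by rewrite ler_wpM2l // mo_decr.
rewrite mulrBl lerD2l lerN2.
have h := mo_rho N.*2.-1; rewrite prednK ?double_gt0 // in h.
have -> : th ^+ 2 * y / (2 * rho) * mo N.*2 = th ^+ 2 * y / 2 * (mo N.*2 / rho).
  by field; rewrite gt_eqF.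
by rewrite ler_wpM2l ?divr_ge0 ?mulr_ge0 ?sqr_ge0 // ler_pdivlMr // mulrC.
Qed.
End negative_update.

End rank1_update.

End psd_matrices.

(** * Independence of bounded random variables *)

Section bounded_measurable.
Context (R : realType) d (T : measurableType d).
Implicit Types (f g : T -> R) (A : set T).

(** Boundedness is stable under sums and products and gives integrability for every probability, so
    no integrability condition has to be carried along. *)
Definition bmfun f := measurable_fun setT f /\ exists M : R, forall x, `|f x| <= M.

Lemma bmfun_cst (c : R) : bmfun (fun _ => c).
Proof. by split; [exact: measurable_cst | exists `|c|]. Qed.

Lemma bmfunD f g : bmfun f -> bmfun g -> bmfun (fun x => f x + g x).
Proof.
move=> [mf [M fM]] [mg [M' gM]]; split; first exact: measurable_funD.
by exists (M + M') => x; rewrite (le_trans (ler_normD _ _)) // lerD.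
Qed.

Lemma bmfunM f g : bmfun f -> bmfun g -> bmfun (fun x => f x * g x).
Proof.
move=> [mf [M fM]] [mg [M' gM]]; split; first exact: measurable_funM.
by exists (M * M') => x; rewrite normrM ler_pM.
Qed.

Lemma bmfunZ c f : bmfun f -> bmfun (fun x => c * f x).
Proof. by apply: bmfunM; exact: bmfun_cst. Qed.

Lemma bmfun_sum (I : Type) (s : seq I) (F : I -> T -> R) :
  (forall i, bmfun (F i)) -> bmfun (fun x => \sum_(i <- s) F i x).
Proof.
move=> bF; elim: s => [|i s IHs].
  by under eq_fun do rewrite big_nil; exact: bmfun_cst.
by under eq_fun do rewrite big_cons; exact: bmfunD.
Qed.

Lemma bmfun_prod (I : Type) (s : seq I) (F : I -> T -> R) :
  (forall i, bmfun (F i)) -> bmfun (fun x => \prod_(i <- s) F i x).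
Proof.
move=> bF; elim: s => [|i s IHs].
  by under eq_fun do rewrite big_nil; exact: bmfun_cst.
by under eq_fun do rewrite big_cons; exact: bmfunM.
Qed.

Lemma bmfun_indic A : measurable A -> bmfun (\1_A : T -> R).
Proof.
move=> mA; split; first exact: measurable_indic.
by exists 1 => x; rewrite indicE normr_nat; case: (x \in A).
Qed.

Lemma bmfun_superlevel f t : bmfun f -> measurable [set x | t <= f x].
Proof.
move=> [mf _]; rewrite -[X in measurable X]setTI.
have -> : [set x | t <= f x] = f @^-1` `[t, +oo[%classic.
  by apply/seteqP; split=> x /=; rewrite in_itv /= andbT.
by apply: mf.
Qed.

Variable P : probability T R.

Definition mean f : R := Rintegral P setT f.

Lemma bmfun_integrable f : bmfun f -> P.-integrable setT (EFin \o f).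
Proof.
move=> [mf [M fM]]; apply: measurable_bounded_integrable => //.
  by rewrite (le_lt_trans (probability_le1 _ _)) // ltry.
by exists M; split; [exact: num_real | move=> x Mx y _; exact: le_trans (fM y) (ltW Mx)].
Qed.

Lemma meanD f g : bmfun f -> bmfun g -> mean (fun x => f x + g x) = mean f + mean g.
Proof. by move=> bf bg; apply: RintegralD => //; exact: bmfun_integrable. Qed.

Lemma meanZ c f : bmfun f -> mean (fun x => c * f x) = c * mean f.
Proof. by move=> bf; apply: RintegralZl => //; exact: bmfun_integrable. Qed.

Lemma mean_cst c : mean (fun _ => c) = c.
Proof.
rewrite /mean Rintegral_cst // -[RHS]mulr1; congr (_ * _).
by rewrite -[RHS]/(fine 1%E); congr fine; exact: probability_setT.
Qed.

Lemma mean_sum (I : Type) (s : seq I) (F : I -> T -> R) :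
  (forall i, bmfun (F i)) ->
  mean (fun x => \sum_(i <- s) F i x) = \sum_(i <- s) mean (F i).
Proof.
move=> bF; elim: s => [|i s IHs].
  by under eq_fun do rewrite big_nil; rewrite big_nil mean_cst.
under eq_fun do rewrite big_cons; rewrite big_cons meanD ?IHs //.
exact: bmfun_sum.
Qed.

Lemma le_mean f g : bmfun f -> bmfun g -> (forall x, f x <= g x) -> mean f <= mean g.
Proof. by move=> bf bg fg; apply: le_Rintegral => //; exact: bmfun_integrable. Qed.

Lemma mean_ge0 f : (forall x, 0 <= f x) -> 0 <= mean f.
Proof. by move=> f0; exact: Rintegral_ge0. Qed.

Lemma mean_norm_le f M : bmfun f -> (forall x, `|f x| <= M) -> `|mean f| <= M.
Proof.
move=> bf fM; have fM' x : - M <= f x <= M by rewrite -ler_norml.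
rewrite ler_norml; apply/andP; split.
  rewrite -(mean_cst (- M)); apply: le_mean => //; first exact: bmfun_cst.
  by move=> x; case/andP: (fM' x).
rewrite -(mean_cst M); apply: le_mean => //; first exact: bmfun_cst.
by move=> x; case/andP: (fM' x).
Qed.

Lemma mean_indic A : measurable A -> (mean \1_A)%:E = P A.
Proof.
move=> mA; rewrite /mean /Rintegral integral_indic // setIT fineK //.
by rewrite fin_num_measure.
Qed.

Lemma mean_markov f t : bmfun f -> (forall x, 0 <= f x) -> 0 < t ->
  (P [set x | (t <= f x)%R] <= (mean f / t)%:E)%E.
Proof.
move=> bf f0 t0; have mA := bmfun_superlevel t bf.
rewrite -mean_indic // lee_fin ler_pdivlMr // mulrC -meanZ; last exact: bmfun_indic.
apply: le_mean => //; first by apply: bmfunZ; exact: bmfun_indic.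
move=> x; rewrite indicE; have [|] := boolP (x \in _); last by rewrite mulr0.
by rewrite inE /= mulr1.
Qed.

End bounded_measurable.

Lemma bmfun_comp (R : realType) d (T : measurableType d) d' (T' : measurableType d')
    (Y : T' -> T) (f : T -> R) :
  measurable_fun setT Y -> bmfun f -> bmfun (f \o Y).
Proof.
by move=> mY [mf [M fM]]; split; [exact: measurableT_comp | exists M => x; exact: fM].
Qed.

Section independence.
Context (R : realType) (dO dT : measure_display) (Omega : measurableType dO)
  (T : measurableType dT) (Pr : probability Omega R).
Implicit Types (W : Omega -> R) (h : T -> R).

Local Notation E := (mean Pr).

(* Removing [M/2] times the indicator of [{h >= M/2}] halves the range of [h]
   and leaves the covariance unchanged. *)
Lemma mean_mul_indep W (Y : Omega -> T) : bmfun W -> measurable_fun setT Y ->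
  (forall A, measurable A -> E (fun w => W w * \1_A (Y w)) = E W * E (\1_A \o Y)) ->
  forall h, bmfun h -> E (fun w => W w * h (Y w)) = E W * E (h \o Y).
Proof.
move=> bW mY WA h bh.
have [_ [B WB]] := bW.
have B0 : 0 <= B by rewrite (le_trans _ (WB point)).
(* The covariance of W and g (Y) is linear in g, vanishes on indicators and is at most 2 B M when 0
   <= g <= M. *)
pose D g := E (fun w => W w * g (Y w)) - E W * E (g \o Y).
have bY (g : T -> R) : bmfun g -> bmfun (g \o Y) by exact: bmfun_comp.
have bWY (g : T -> R) : bmfun g -> bmfun (fun w => W w * g (Y w)).
  by move=> bg; exact: bmfunM bW (bY _ bg).
have DD g1 g2 : bmfun g1 -> bmfun g2 -> D (fun x => g1 x + g2 x) = D g1 + D g2.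
  move=> b1 b2; rewrite /D.
  have -> : (fun w => W w * (g1 (Y w) + g2 (Y w))) =
     (fun w => W w * g1 (Y w) + W w * g2 (Y w)) by apply/funext => w; rewrite mulrDr.
  rewrite meanD; [|exact: bWY..].
  rewrite [E (_ \o Y)](_ : _ = E (g1 \o Y) + E (g2 \o Y)); first by ring.
  exact: (meanD Pr (bY _ b1) (bY _ b2)).
have DZ c g : bmfun g -> D (fun x => c * g x) = c * D g.
  move=> bg; rewrite /D.
  have -> : (fun w => W w * (c * g (Y w))) = (fun w => c * (W w * g (Y w))).
    by apply/funext => w; ring.
  rewrite meanZ; last exact: bWY.
  rewrite [E (_ \o Y)](_ : _ = c * E (g \o Y)); first by ring.
  exact: (meanZ Pr c (bY _ bg)).
have DA A : measurable A -> D \1_A = 0 by move=> mA; rewrite /D WA // subrr.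
have Dle g M : bmfun g -> (forall x, 0 <= g x <= M) -> `|D g| <= 2 * B * M.
  move=> bg gM; have gM' x : `|g x| <= M by case/andP: (gM x) => ? ?; rewrite ger0_norm.
  rewrite (le_trans (ler_normB _ _)) // -mulrA mulr_natl mulr2n lerD //.
    apply: mean_norm_le; first exact: bWY.
    by move=> w; rewrite normrM ler_pM.
  rewrite normrM ler_pM //; first exact: mean_norm_le.
  by apply: mean_norm_le; [exact: bY _ bg | move=> w; exact: gM'].
have Dle2 k : forall g M, bmfun g -> (forall x, 0 <= g x <= M) ->
    `|D g| <= 2 * B * M / 2 ^+ k.
  elim: k => [|k IHk] g M bg gM; first by rewrite expr0 divr1 Dle.
  pose A := g @^-1` `[M / 2, +oo[%classic.
  have mA : measurable A by rewrite -[A]setTI; case: bg => mg _; exact: mg.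
  have bA : bmfun (\1_A : T -> R) by exact: bmfun_indic.
  have -> : g = (fun x => (g x - M / 2 * \1_A x) + M / 2 * \1_A x).
    by apply/funext => x; rewrite subrK.
  have bg' : bmfun (fun x => g x - M / 2 * \1_A x).
    by under eq_fun do rewrite -mulNr; apply: bmfunD => //; exact: bmfunZ.
  rewrite DD //; last exact: bmfunZ.
  rewrite DZ // DA // mulr0 addr0 exprS invfM mulrA -[_ * M / 2]mulrA.
  apply: IHk => // x; rewrite indicE; have /andP[g0 g1] := gM x.
  have [Ax|nAx] := pselect (A x).
    rewrite mem_set // mulr1 subr_ge0; move: Ax; rewrite /A /= in_itv /= andbT => ->.
    by rewrite lerBlDr -splitr.
  rewrite memNset // mulr0 subr0 g0 ltW // ltNge; apply/negP => h'.
  by apply: nAx; rewrite /A /= in_itv /= andbT.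
have D0 g M : bmfun g -> (forall x, 0 <= g x <= M) -> D g = 0.
  move=> bg gM; apply/eqP; rewrite -normr_le0 leNgt; apply/negP => Dp.
  pose k := Num.Def.archi_bound (2 * B * M / `|D g|).
  have := Dle2 k g M bg gM; apply/negP; rewrite -ltNge ltr_pdivrMr ?exprn_gt0 //.
  rewrite [ltRHS]mulrC -ltr_pdivrMr // (lt_le_trans (archi_boundP _)) //.
    have M0 : 0 <= M by case/andP: (gM point) => a b; exact: le_trans b.
    by rewrite divr_ge0 // !mulr_ge0.
  by rewrite -natrX ler_nat ltnW // ltn_expl.
have [_ [M hM]] := bh.
have hM' x : - M <= h x <= M by rewrite -ler_norml.
apply/eqP; rewrite -subr_eq0 -/(D h); apply/eqP.
(* Adding the constant M, seen as a multiple of an indicator, makes h nonnegative and leaves D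
   unchanged. *)
have bM : bmfun (fun x : T => M * \1_(setT : set T) x).
  by apply: bmfunZ; exact: bmfun_indic.
have := DD h _ bh bM; rewrite DZ; last exact: bmfun_indic.
rewrite DA // mulr0 addr0 => <-; apply: (D0 _ (2 * M)).
  exact: bmfunD.
move=> x; rewrite indicE in_setT mulr1; case/andP: (hM' x) => a b.
by rewrite -lerBlDr sub0r a mulr_natl mulr2n lerD2r.
Qed.

Variables (n : nat) (X : 'I_n -> {RV Pr >-> T}).
Hypothesis X_indep : mutually_independent X.

Lemma mean_prod_indic (A : 'I_n -> set T) : (forall i, measurable (A i)) ->
  E (fun w => \prod_i \1_(A i) (X i w)) = \prod_i E (\1_(A i) \o X i).
Proof.
move=> mA; apply: EFin_inj.
have mXA i : measurable (X i @^-1` A i).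
  by rewrite -[_ @^-1` _]setTI; exact: measurable_funPT.
have -> : (fun w => \prod_i \1_(A i) (X i w)) =
    (\1_(\bigcap_(i in [set` [set: 'I_n]%SET]) (X i @^-1` A i)) : Omega -> R).
  apply/funext => w; rewrite indicE.
  have [h|h] := pselect ((\bigcap_(i in [set` [set: 'I_n]%SET]) (X i @^-1` A i)) w).
    rewrite mem_set // big1 // => i _; rewrite indicE mem_set //.
    by apply: (h i); rewrite /= finset.in_setT.
  rewrite memNset //; have /existsNP[i /not_implyP[_ hi]] := h.
  by rewrite (bigD1 i) //= indicE memNset // mul0r.
rewrite mean_indic; last exact: fin_bigcap_measurable.
rewrite X_indep // -prodEFin; apply: eq_big => [i|i _]; first by rewrite finset.in_setT.
by rewrite -mean_indic.
Qed.

(** Induction on the number k of leading coordinates that may be arbitrary, the others being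
    indicators; [mean_mul_indep] frees one more coordinate. *)
Lemma mean_prod (f : 'I_n -> T -> R) : (forall i, bmfun (f i)) ->
  E (fun w => \prod_i f i (X i w)) = \prod_i E (f i \o X i).
Proof.
have bX i (h : T -> R) : bmfun h -> bmfun (h \o X i) by apply: bmfun_comp; exact: measurable_funPT.
suff S k : forall f : 'I_n -> T -> R, (forall i, bmfun (f i)) ->
    (forall i : 'I_n, (k <= i)%N -> exists2 A, measurable A & f i = \1_A) ->
    E (fun w => \prod_i f i (X i w)) = \prod_i E (f i \o X i).
  by move=> bf; apply: (S n) => // i; rewrite leqNgt ltn_ord.
elim: k => [|k IHk] {}f bf fA.
  have /choice[A hA] : forall i, exists A, measurable A /\ f i = \1_A.
    by move=> i; have [//|A mA fE] := fA i; exists A.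
  have -> : f = (fun i => \1_(A i)) by apply/funext => i; case: (hA i).
  by apply: mean_prod_indic => i; case: (hA i).
have [kn|nk] := ltnP k n; last first.
  by apply: IHk => // i ki; exfalso; move: (ltn_ord i); rewrite ltnNge (leq_trans nk).
pose i0 := Ordinal kn.
pose W w := \prod_(i | i != i0) f i (X i w).
pose f' h i := if i == i0 then h else f i.
have f'W h w : \prod_i f' h i (X i w) = W w * h (X i0 w).
  rewrite (bigD1 i0) //= /f' eqxx mulrC; congr (_ * _).
  by apply: eq_bigr => i /negbTE ->.
have f'E h : \prod_i E (f' h i \o X i) = (\prod_(i | i != i0) E (f i \o X i)) * E (h \o X i0).
  rewrite (bigD1 i0) //= /f' eqxx mulrC; congr (_ * _).
  by apply: eq_bigr => i /negbTE ->.
have IH A : measurable A -> E (fun w => W w * \1_A (X i0 w)) =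
    (\prod_(i | i != i0) E (f i \o X i)) * E (\1_A \o X i0).
  move=> mA; rewrite -f'E -IHk; first by under [in RHS]eq_fun do rewrite f'W.
    by rewrite /f' => i; case: ifP => // _; exact: bmfun_indic.
  rewrite /f' => i ki; case: ifPn => [_|ni]; first by exists A.
  by apply: fA; rewrite ltn_neqAle ki andbT; apply: contra ni => /eqP e; apply/eqP/val_inj.
have bW : bmfun W.
  rewrite /W; under eq_fun do rewrite -big_filter.
  by apply: bmfun_prod => i; exact: bX.
have WE : E W = \prod_(i | i != i0) E (f i \o X i).
  (* The indicator of the whole space identifies the mean of W. *)
  have := IH setT measurableT; rewrite indicT /=.
  have -> : (fun w => W w * 1) = W by apply/funext => w; rewrite mulr1.
  by rewrite /comp mean_cst mulr1.
have fE : f = f' (f i0) by apply/funext => i; rewrite /f'; case: eqP => [->|].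
have mX : measurable_fun setT (X i0) by exact: measurable_funPT.
have WI A : measurable A -> E (fun w => W w * \1_A (X i0 w)) = E W * E (\1_A \o X i0).
  by move=> mA; rewrite IH // WE.
have := mean_mul_indep bW mX WI (bf i0).
rewrite WE -f'E -fE => <-; congr (mean _ _); apply/funext => w.
by rewrite -f'W -fE.
Qed.

(* The algebra generated by bounded functions of [X 0, ..., X j.-1]. *)
Definition sum_prod (j : nat) (W : Omega -> R) :=
  exists (K : finType) (c : K -> R) (F : K -> 'I_n -> T -> R),
  [/\ forall k i, bmfun (F k i),
      forall k (i : 'I_n), (j <= i)%N -> F k i = (fun _ => 1) &
      W = fun w => \sum_k c k * \prod_i F k i (X i w)].

Lemma sum_prod_bmfun j W : sum_prod j W -> bmfun W.
Proof.
move=> [K [c [F [bF _ ->]]]]; apply: bmfun_sum => k; apply: bmfunZ.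
by apply: bmfun_prod => i; exact: (bmfun_comp (measurable_funPT (X i)) (bF k i)).
Qed.

Lemma sum_prod_cst j (c : R) : sum_prod j (fun _ => c).
Proof.
exists unit, (fun _ => c), (fun _ _ _ => 1); split=> //.
  by move=> _ _; exact: bmfun_cst.
by apply/funext => w; rewrite big_const card_unit /= addr0 big1 ?mulr1.
Qed.

Lemma sum_prod_gen j (i0 : 'I_n) h : (i0 < j)%N -> bmfun h ->
  sum_prod j (fun w => h (X i0 w)).
Proof.
move=> ij bh; exists unit, (fun _ => 1), (fun _ i => if i == i0 then h else fun _ => 1).
split=> [_ i|_ i ji|].
- by case: ifP => // _; exact: bmfun_cst.
- by case: eqP => // ii; move: ij; rewrite -ii ltnNge ji.
apply/funext => w; rewrite big_const card_unit /= addr0 mul1r (bigD1 i0) //= eqxx.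
by rewrite big1 ?mulr1 // => i /negbTE ->.
Qed.

Lemma sum_prodD j W1 W2 : sum_prod j W1 -> sum_prod j W2 ->
  sum_prod j (fun w => W1 w + W2 w).
Proof.
move=> [K1 [c1 [F1 [b1 j1 ->]]]] [K2 [c2 [F2 [b2 j2 ->]]]].
exists (K1 + K2)%type, (fun k => match k with inl a => c1 a | inr b => c2 b end),
  (fun k => match k with inl a => F1 a | inr b => F2 b end); split.
- by move=> [].
- by move=> [].
by apply/funext => w; rewrite big_sumType.
Qed.

Lemma sum_prodM j W1 W2 : sum_prod j W1 -> sum_prod j W2 ->
  sum_prod j (fun w => W1 w * W2 w).
Proof.
move=> [K1 [c1 [F1 [b1 j1 ->]]]] [K2 [c2 [F2 [b2 j2 ->]]]].
exists (K1 * K2)%type, (fun k => c1 k.1 * c2 k.2),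
  (fun k i x => F1 k.1 i x * F2 k.2 i x); split.
- by move=> k i; exact: bmfunM.
- by move=> k i ji; apply/funext => x; rewrite j1 // j2 // mulr1.
apply/funext => w; rewrite big_distrlr /= pair_bigA; apply: eq_bigr => k _ /=.
by rewrite big_split /=; ring.
Qed.

Lemma sum_prod_sum j (I : Type) (s : seq I) (F : I -> Omega -> R) :
  (forall i, sum_prod j (F i)) -> sum_prod j (fun w => \sum_(i <- s) F i w).
Proof.
move=> bF; elim: s => [|i s IHs].
  by under eq_fun do rewrite big_nil; exact: sum_prod_cst.
by under eq_fun do rewrite big_cons; exact: sum_prodD.
Qed.

(** In each product the slot i0 holds the constant 1, because j <= i0, and can receive h; the
    product formula then applies to both sides. *)
Lemma mean_sum_prodM j W (i0 : 'I_n) h : sum_prod j W -> (j <= i0)%N -> bmfun h ->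
  E (fun w => W w * h (X i0 w)) = E W * E (h \o X i0).
Proof.
have bX i (g : T -> R) : bmfun g -> bmfun (g \o X i) by apply: bmfun_comp; exact: measurable_funPT.
move=> [K [c [F [bF jF ->]]]] ji bh.
pose F' k i := if i == i0 then h else F k i.
have bF' k i : bmfun (F' k i) by rewrite /F'; case: ifP.
have -> : (fun w => (\sum_k c k * \prod_i F k i (X i w)) * h (X i0 w)) =
    (fun w => \sum_k c k * \prod_i F' k i (X i w)).
  apply/funext => w; rewrite mulr_suml; apply: eq_bigr => k _; rewrite -mulrA; congr (_ * _).
  rewrite (bigD1 i0) //= [in RHS](bigD1 i0) //= /F' eqxx jF // mul1r mulrC; congr (_ * _).
  by apply: eq_bigr => i /negbTE ->.
rewrite !mean_sum; try by move=> k; apply: bmfunZ; apply: bmfun_prod => i; exact: bX.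
rewrite mulr_suml; apply: eq_bigr => k _.
rewrite !meanZ; try by apply: bmfun_prod => i; exact: bX.
rewrite !mean_prod // -mulrA; congr (_ * _).
rewrite (bigD1 i0) //= [in RHS](bigD1 i0) //= /F' eqxx jF // mulrC; congr (_ * _).
rewrite [in X in _ = X * _]/comp mean_cst mul1r.
by apply: eq_bigr => i /negbTE ->.
Qed.

End independence.

(** * Elementary bounds on the exponential *)

Section exp_bounds.
Context {R : realType}.

(** The function (2 - x) exp x - x has derivative (1 - x) exp x - 1, nonpositive since 1 - x <= exp
    (- x). *)
Lemma expR_pade (u : R) : 0 <= u -> (2 - u) * expR u <= 2 + u.
Proof.
move=> u0; pose f : R -> R := fun x => (2 - x) * expR x - x.
have df (x : R) : is_derive x 1 f ((1 - x) * expR x - 1).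
  by rewrite /f; apply: is_derive_eq; rewrite /GRing.scale /=; ring.
suff : f u <= f 0 by rewrite /f subr0 expR0 mulr1 subr0 lerBlDr.
have cf : {within `[0, u], continuous f}.
  apply: continuous_subspaceT => x; apply: differentiable_continuous.
  by apply/derivable1_diffP; case: (df x).
have [c _ fc] := MVT_segment u0 (fun x _ => df x) cf.
rewrite -subr_le0 fc mulr_le0_ge0 ?subr_ge0 // subr_le0 mulrC -ler_pdivlMl ?expR_gt0 //.
by rewrite mulr1 -expRN; have := expR_ge1Dx (- c).
Qed.

(** Multiplied by 2 - u, the right-hand side exceeds 2 + u by 3/4 u ^ 2 (2/3 - u), whence the
    range. *)
Lemma expR_le_quadratic (u : R) : 0 <= u <= 2 / 3 -> expR u <= 1 + u + 3 / 4 * u ^+ 2.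
Proof.
case/andP=> u0 u1; have h := expR_pade u0.
have u2 : 0 < 2 - u by lra.
rewrite -(ler_pM2l u2) (le_trans h) //.
have : 0 <= u ^+ 2 * (2 / 3 - u) by rewrite mulr_ge0 ?sqr_ge0 ?subr_ge0.
by rewrite !expr2; nra.
Qed.

(** For one factor, with y = x / N: exp (y - y ^ 2) <= 1 + y, because (1 - y + y ^ 2) (1 + y) = 1 +
    y ^ 3. *)
Lemma expR_le_1DX (x : R) (N : nat) : (0 < N)%N -> 0 <= x ->
  expR (x - x ^+ 2 / N%:R) <= (1 + x / N%:R) ^+ N.
Proof.
move=> N0 x0; have NR : 0 < N%:R :> R by rewrite ltr0n.
have y0 : 0 <= x / N%:R by rewrite divr_ge0.
have -> : x - x ^+ 2 / N%:R = N%:R * (x / N%:R - (x / N%:R) ^+ 2).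
  by field; rewrite gt_eqF.
rewrite expRM_natl lerXn2r ?nnegrE ?expR_ge0 ?addr_ge0 //.
set y := x / N%:R in y0 *.
rewrite -[leRHS]invrK -[leLHS]invrK lef_pV2 ?posrE ?invr_gt0 ?expR_gt0 ?ltr_wpDr //.
rewrite -expRN opprB; apply: le_trans (expR_ge1Dx _).
rewrite -div1r ler_pdivrMr; last by rewrite ltr_wpDr.
nra.
Qed.

(** For one factor, with y = x / N <= 1/2: exp (- y - 2 y ^ 2) <= 1 - y, because (1 + y + 2 y ^ 2)
    (1 - y) = 1 + y ^ 2 (1 - 2 y). *)
Lemma expR_le_1BX (x : R) (N : nat) : (0 < N)%N -> 0 <= x -> 2 * x <= N%:R ->
  expR (- (x + 2 * x ^+ 2 / N%:R)) <= (1 - x / N%:R) ^+ N.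
Proof.
move=> N0 x0 xN; have NR : 0 < N%:R :> R by rewrite ltr0n.
have y0 : 0 <= x / N%:R by rewrite divr_ge0.
have y1 : x / N%:R <= 1 / 2 by rewrite ler_pdivrMr //; lra.
have -> : - (x + 2 * x ^+ 2 / N%:R) = N%:R * (- (x / N%:R + 2 * (x / N%:R) ^+ 2)).
  by field; rewrite gt_eqF.
rewrite expRM_natl.
set y := x / N%:R in y0 y1 *.
have yp : 0 < 1 - y by lra.
rewrite lerXn2r ?nnegrE ?expR_ge0 ?(ltW yp) //.
rewrite expRN -[leRHS]invrK lef_pV2 ?posrE ?invr_gt0 ?expR_gt0 //.
apply: le_trans (expR_ge1Dx _).
rewrite -div1r ler_pdivrMr //; nra.
Qed.

End exp_bounds.

(** * Concentration of empirical Gram matrices *)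

Section matrix_chernoff.
Context (R : realType) (dO dT : measure_display) (Omega : measurableType dO)
  (T : measurableType dT) (Pr : probability Omega R)
  (n : nat) (X : 'I_n -> {RV Pr >-> T}) (r : nat) (v : T -> 'rV[R]_r.+1) (M : R).
Hypothesis X_indep : mutually_independent X.
Hypothesis v_bm : forall k, bmfun (fun x => v x 0 k).
Hypothesis v_le : forall x, bform 1 (v x) (v x) <= M.
Hypothesis v_iso : forall i k l,
  mean Pr (fun w => v (X i w) 0 k * v (X i w) 0 l) = (k == l)%:R.

(** Partial sums let the samples enter one at a time, each independent of the sum it is added to. *)
Definition gram_sum (j : nat) (w : Omega) : 'M[R]_r.+1 :=
  \sum_(i < n | (i < j)%N) rank1 (v (X i w)).

Definition pencil (e : R) j w : 'M[R]_r.+1 := 1 + e *: gram_sum j w.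

Lemma pencil0 e w : pencil e 0 w = 1.
Proof. by rewrite /pencil /gram_sum big1 ?scaler0 ?addr0. Qed.

Lemma pencilS e (i : 'I_n) w :
  pencil e i.+1 w = pencil e i w + e *: rank1 (v (X i w)).
Proof.
rewrite /pencil -addrA -scalerDr; congr (_ + _ *: _).
rewrite /gram_sum (bigD1 i) //= addrC; congr (_ + _).
by apply: eq_bigl => k; rewrite ltnS ltn_neqAle andbC.
Qed.

Lemma bform_gram_sum j w u :
  bform (gram_sum j w) u u = \sum_(i < n | (i < j)%N) bform (rank1 (v (X i w))) u u.
Proof. by rewrite /gram_sum -big_filter bform_sumr big_filter. Qed.

Lemma gram_sum_ge0 j w u : 0 <= bform (gram_sum j w) u u.
Proof. by rewrite bform_gram_sum sumr_ge0 // => i _; exact: bform_rank1_ge0. Qed.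

Lemma gram_sum_le j w u : bform (gram_sum j w) u u <= n%:R * M * bform 1 u u.
Proof.
rewrite bform_gram_sum (@le_trans _ _ (\sum_(i < n) M * bform 1 u u)) //.
  rewrite [leRHS](bigID (fun i : 'I_n => (i < j)%N)) /= ler_wpDr //.
    apply: sumr_ge0 => i _; rewrite mulr_ge0 ?bform1_ge0 //.
    exact: le_trans (bform1_ge0 _) (v_le point).
  apply: ler_sum => i _; rewrite (le_trans (bform1_rank1_le _ _)) // mulrC.
  by rewrite ler_wpM2r ?bform1_ge0.
by rewrite sumr_const card_ord -[leLHS]mulr_natl mulrA.
Qed.

Lemma gram_sum_sym j w : (gram_sum j w)^T = gram_sum j w.
Proof.
apply/matrixP => k l; rewrite mxE /gram_sum !summxE.
apply: eq_bigr => i _.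
by have := congr1 (fun B : 'M[R]_r.+1 => B k l) (rank1_tr (v (X i w))); rewrite mxE.
Qed.

Lemma pencil_sym e j w : (pencil e j w)^T = pencil e j w.
Proof.
apply/matrixP => k l.
have := congr1 (fun B : 'M[R]_r.+1 => B k l) (gram_sum_sym j w).
have := congr1 (fun B : 'M[R]_r.+1 => B k l) (trmx1 R r.+1).
by rewrite /pencil [gram_sum j w]lock !mxE -lock => -> ->.
Qed.

Lemma bform_pencil e j w u :
  bform (pencil e j w) u u = bform 1 u u + e * bform (gram_sum j w) u u.
Proof. by rewrite /pencil bformDm bformZm. Qed.

Definition mat_sum_prod j (A : Omega -> 'M[R]_r.+1) :=
  forall k l, sum_prod X j (fun w => A w k l).

Lemma mat_sum_prodM j A B : mat_sum_prod j A -> mat_sum_prod j B ->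
  mat_sum_prod j (fun w => A w * B w).
Proof.
move=> hA hB k l; under eq_fun do rewrite -mulmxE mxE.
by apply: sum_prod_sum => i; exact: sum_prodM.
Qed.

Lemma mat_sum_prodX j A N : mat_sum_prod j A -> mat_sum_prod j (fun w => A w ^+ N).
Proof.
move=> hA; elim: N => [|N IHN].
  by move=> k l; under eq_fun do rewrite expr0; exact: sum_prod_cst.
by under eq_fun do rewrite exprS; exact: mat_sum_prodM.
Qed.

Lemma mat_sum_prod_pencil e j : mat_sum_prod j (pencil e j).
Proof.
move=> k l; rewrite /pencil; under eq_fun do rewrite mxE [X in _ + X]mxE.
apply: sum_prodD; first exact: sum_prod_cst.
apply: sum_prodM; first exact: sum_prod_cst.
rewrite /gram_sum; under eq_fun do rewrite summxE big_mkcond.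
have H (i : 'I_n) : sum_prod X j
    (fun w => if (i < j)%N then rank1 (v (X i w)) k l else 0).
  case ij: (i < j)%N; last exact: sum_prod_cst.
  have b : bmfun (fun x => v x 0 k * v x 0 l) by exact: bmfunM.
  have -> : (fun w => rank1 (v (X i w)) k l) = (fun w => v (X i w) 0 k * v (X i w) 0 l).
    by apply/funext => w; rewrite /rank1 mxE big_ord1 mxE.
  exact: (sum_prod_gen X ij b).
exact: (sum_prod_sum (index_enum _) H).
Qed.

Lemma trace_bmfun e j N : bmfun (fun w => \tr (pencil e j w ^+ N)).
Proof.
apply: bmfun_sum => k; apply: (@sum_prod_bmfun _ _ _ _ _ _ _ X j).
exact: (mat_sum_prodX N (mat_sum_prod_pencil e j)).
Qed.

(** The entries of the power depend on earlier samples only, so every term factors; isotropy removes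
    the off-diagonal terms and leaves the trace. *)
Lemma mean_bform_pencil e (i : 'I_n) N :
  bmfun (fun w => bform (pencil e i w ^+ N) (v (X i w)) (v (X i w))) /\
  mean Pr (fun w => bform (pencil e i w ^+ N) (v (X i w)) (v (X i w))) =
  mean Pr (fun w => \tr (pencil e i w ^+ N)).
Proof.
have hP := mat_sum_prodX N (mat_sum_prod_pencil e i).
have bvv k l : bmfun (fun x => v x 0 k * v x 0 l) by exact: bmfunM.
have bvX k l : bmfun (fun w => v (X i w) 0 k * v (X i w) 0 l).
  exact: (bmfun_comp (measurable_funPT (X i)) (bvv k l)).
have bP k l : bmfun (fun w => (pencil e i w ^+ N) k l) by exact: sum_prod_bmfun (hP k l).
have bPv k l := bmfunM (bP k l) (bvX k l).
under eq_fun do rewrite bformE; split.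
  by do 2 (apply: bmfun_sum => ?).
rewrite mean_sum; last by move=> k; exact: bmfun_sum.
rewrite /mxtrace mean_sum //; apply: eq_bigr => k _.
rewrite mean_sum // (bigD1 k) //= big1 ?addr0.
  rewrite (mean_sum_prodM X_indep (hP k k) (leqnn _) (bvv k k)).
  by rewrite [X in _ * X](v_iso i k k) eqxx mulr1.
move=> l lk; rewrite (mean_sum_prodM X_indep (hP k l) (leqnn _) (bvv k l)).
by rewrite [X in _ * X](v_iso i k l) eq_sym (negbTE lk) mulr0.
Qed.

Lemma mean_trace_pencil_le e N g : 0 <= 1 + g ->
  (forall (i : 'I_n) w, \tr (pencil e i.+1 w ^+ N) <=
     \tr (pencil e i w ^+ N) + g * bform (pencil e i w ^+ N) (v (X i w)) (v (X i w))) ->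
  mean Pr (fun w => \tr (pencil e n w ^+ N)) <= (1 + g) ^+ n * r.+1%:R.
Proof.
move=> g0 step.
suff H j : (j <= n)%N -> mean Pr (fun w => \tr (pencil e j w ^+ N)) <= (1 + g) ^+ j * r.+1%:R.
  exact: H.
elim: j => [_|j IHj jn].
  under eq_fun do rewrite pencil0 expr1n mxtrace1.
  by rewrite mean_cst expr0 mul1r.
have [b1 E1] := mean_bform_pencil e (Ordinal jn) N.
have b0 := trace_bmfun e j N.
apply: (@le_trans _ _ ((1 + g) * mean Pr (fun w => \tr (pencil e j w ^+ N)))).
  rewrite mulrDl mul1r -{2}E1 -meanZ // -meanD //; last exact: bmfunZ.
  apply: le_mean; [exact: trace_bmfun | by apply: bmfunD => //; exact: bmfunZ|].
  by move=> w; exact: (step (Ordinal jn) w).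
by rewrite exprS -mulrA ler_wpM2l // IHj // ltnW.
Qed.

Let M_ge0 : 0 <= M. Proof. exact: le_trans (bform1_ge0 _) (v_le point). Qed.

Let psd_pencil e j w : 0 <= e -> psd (pencil e j w).
Proof.
move=> e0; split; first exact: pencil_sym.
by move=> u; rewrite bform_pencil addr_ge0 ?bform1_ge0 // mulr_ge0 ?gram_sum_ge0.
Qed.

(** With x = n th t, the exceptional event is that the trace reaches (1 + x / N)^N. A direction
    violating the conclusion multiplies the moments of the pencil by at least 1 + x / N at each
    step, so it would force the trace up to that level. *)
Lemma gram_upper_tail (th t : R) (N : nat) : (0 < N)%N -> 0 < M ->
  0 <= th -> 0 <= t ->
  exists2 B, measurable B &
    (Pr B <= (r.+1%:R * expR (n%:R * ((expR (th * M) - 1) / M)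
                 - (n%:R * th * t - (n%:R * th * t) ^+ 2 / N%:R)))%:E)%E /\
    forall w, ~ B w -> forall u, bform (gram_sum n w) u u <= n%:R * t * bform 1 u u.
Proof.
move=> N0 M0 th0 t0; have NR : 0 < N%:R :> R by rewrite ltr0n.
pose e := th / N%:R; have e0 : 0 <= e by rewrite divr_ge0.
pose g := e * \sum_(b < N) (1 + e * M) ^+ b.
have g0 : 0 <= g.
  by rewrite mulr_ge0 // sumr_ge0 // => b _; rewrite exprn_ge0 // addr_ge0 // mulr_ge0.
have gle : g <= (expR (th * M) - 1) / M.
  rewrite ler_pdivlMr // (_ : g * M = (1 + e * M) ^+ N - 1); last first.
    by rewrite subrX1 [1 + _ - 1]addrAC subrr add0r /g [RHS]mulrAC.
  rewrite lerD2r.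
  have -> : th * M = N%:R * (e * M) by rewrite /e; field; rewrite gt_eqF.
  by rewrite expRM_natl lerXn2r ?nnegrE ?expR_ge0 ?expR_ge1Dx ?addr_ge0 ?mulr_ge0.
have mean_le : mean Pr (fun w => \tr (pencil e n w ^+ N)) <=
    r.+1%:R * expR (n%:R * ((expR (th * M) - 1) / M)).
  apply: le_trans (@mean_trace_pencil_le e N g _ _) _; first by rewrite addr_ge0.
    move=> i w; rewrite pencilS; apply: (trace_rank1_addX_le (psd_pencil _ _ e0) e0).
      exact: v_le.
    by rewrite bform_pencil lerDl mulr_ge0 ?gram_sum_ge0.
  rewrite mulrC ler_wpM2l // expRM_natl lerXn2r ?nnegrE ?expR_ge0 ?addr_ge0 //.
  by apply: (le_trans (expR_ge1Dx _)); rewrite ler_expR.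
pose x := n%:R * th * t.
have x0 : 0 <= x by rewrite !mulr_ge0.
have xp : 0 < (1 + x / N%:R) ^+ N by rewrite exprn_gt0 // ltr_wpDr // divr_ge0.
pose Z w := \tr (pencil e n w ^+ N).
have Z0 w : 0 <= Z w by exact: trace_psd_ge0 (psdX N (psd_pencil _ _ e0)).
exists [set w | (1 + x / N%:R) ^+ N <= Z w].
  exact: bmfun_superlevel (trace_bmfun e n N).
split.
  apply: le_trans (mean_markov _ (trace_bmfun e n N) Z0 xp) _.
  rewrite lee_fin ler_pdivrMr // (le_trans mean_le) // -[leRHS]mulrA ler_wpM2l //.
  rewrite expRD -[leRHS]mulrA -[leLHS]mulr1 ler_wpM2l ?expR_ge0 //.
  rewrite expRN ler_pdivlMl ?expR_gt0 // mulr1; exact: expR_le_1DX.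
move=> w /= /negP; rewrite -ltNge => Zlt u; rewrite leNgt; apply/negP => ult.
have pP := psd_pencil n w e0.
have q0 := bform1_ge0 u.
have h : (1 + x / N%:R) * moment (pencil e n w) u 0 <= moment (pencil e n w) u 1.
  rewrite /moment expr0 expr1 bform_pencil mulrDl mul1r lerD2l.
  have -> : x / N%:R = e * (n%:R * t) by rewrite /x /e; field; rewrite gt_eqF.
  by rewrite -mulrA ler_wpM2l // ltW.
have mge k := moment_ge0 u k pP.
have mlc k := moment_lc u k pP.
have := log_convex_geom mge mlc N _ h.
rewrite addr_ge0 ?divr_ge0 // => /(_ isT); rewrite {1}/moment expr0 => H.
have := le_trans H (trace_psd_ge u (psdX N pP)).
have [u0|un0] := eqVneq (bform 1 u u) 0.
  have := gram_sum_le n w u; rewrite u0 mulr0 => h'.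
  by move: ult; rewrite u0 mulr0 ltNge h'.
have qp : 0 < bform 1 u u by rewrite lt_neqAle eq_sym un0.
by rewrite mulrC ler_pM2l // leNgt Zlt.
Qed.

(** The two conditions on N keep the pencil between 1/2 and 1 and the base of the Markov level at
    least 1/2; th <= 1 keeps the factor gained at each update nonnegative. *)
Lemma gram_lower_tail (th t : R) (K : nat) (N := K.*2.+1) : (0 < K)%N -> 0 < M ->
  0 <= th <= 1 -> th * M <= 1 -> 0 <= t -> 2 * (n%:R * th * t) <= N%:R ->
  2 * (n%:R * th * M) <= N%:R ->
  exists2 B, measurable B &
    (Pr B <= (r.+1%:R * expR (- (n%:R * (th - th ^+ 2 * M / 2 * (1 + 2 * (n%:R * th * M / N%:R))))
                 + (n%:R * th * t + 2 * (n%:R * th * t) ^+ 2 / N%:R)))%:E)%E /\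
    forall w, ~ B w -> forall u, n%:R * t * bform 1 u u <= bform (gram_sum n w) u u.
Proof.
move=> K0 M0 /andP[th0 th1] thM t0 Nt NM; have NR : 0 < N%:R :> R by rewrite ltr0n.
pose e := - (th / N%:R); have e0 : e <= 0 by rewrite oppr_le0 divr_ge0.
pose z := n%:R * th * M / N%:R.
have z0 : 0 <= z by rewrite divr_ge0 // !mulr_ge0.
have z1 : z <= 1 / 2 by rewrite ler_pdivrMr //; lra.
pose rho := 1 - z; have rho0 : 0 < rho by rewrite /rho; lra.
have thE : th = - (e * N%:R) by rewrite /e; field; rewrite gt_eqF.
have Pge j w u : rho * bform 1 u u <= bform (pencil e j w) u u.
  rewrite bform_pencil /rho mulrBl mul1r lerD2l /e mulNr lerN2.
  have -> : z * bform 1 u u = th / N%:R * (n%:R * M * bform 1 u u) by rewrite /z; ring.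
  by rewrite ler_wpM2l ?divr_ge0 ?gram_sum_le.
have pP j w : psd (pencil e j w).
  split; first exact: pencil_sym.
  by move=> u; rewrite (le_trans _ (Pge _ _ _)) // mulr_ge0 ?bform1_ge0 // ltW.
pose a := th - th ^+ 2 * M / (2 * rho).
(* Since 1 / (1 - z) <= 1 + 2 z for 0 <= z <= 1/2, this bounds a from below without a quotient by
   rho. *)
pose a' := th - th ^+ 2 * M / 2 * (1 + 2 * z).
have a'a : a' <= a.
  rewrite lerD2l lerN2 invfM mulrA ler_wpM2l ?divr_ge0 ?mulr_ge0 ?sqr_ge0 //.
  by rewrite -div1r ler_pdivrMr // /rho; nra.
have a1 : 0 <= 1 - a.
  rewrite subr_ge0 (le_trans _ th1) // gerDl oppr_le0.
  by rewrite divr_ge0 ?mulr_ge0 ?sqr_ge0 // ltW.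
have mean_le : mean Pr (fun w => \tr (pencil e n w ^+ N)) <=
    r.+1%:R * expR (- (n%:R * a')).
  apply: le_trans (@mean_trace_pencil_le e N (- a) a1 _) _.
    move=> i w; rewrite pencilS mulNr /a thE.
    apply: (trace_rank1_subX_le (pP i w) e0 (v_le _) (Pge _ _ _) rho0 _ _ K0).
    - by move=> u; rewrite bform_pencil gerDl mulr_le0_ge0 ?gram_sum_ge0.
    - by rewrite -pencilS.
    - by rewrite -thE (le_trans thM) // /rho; lra.
  rewrite mulrC ler_wpM2l // -mulrN expRM_natl lerXn2r ?nnegrE ?expR_ge0 //.
  by rewrite (le_trans (expR_ge1Dx _)) // ler_expR lerN2.
pose x := n%:R * th * t.
have x0 : 0 <= x by rewrite !mulr_ge0.
have xN : x / N%:R <= 1 / 2 by rewrite ler_pdivrMr //; rewrite -/x in Nt; lra.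
have xr : 0 < 1 - x / N%:R by lra.
have xp : 0 < (1 - x / N%:R) ^+ N by rewrite exprn_gt0.
pose Z w := \tr (pencil e n w ^+ N).
have Z0 w : 0 <= Z w by exact: trace_psd_ge0 (psdX N (pP _ _)).
exists [set w | (1 - x / N%:R) ^+ N <= Z w].
  exact: bmfun_superlevel (trace_bmfun e n N).
split.
  apply: le_trans (mean_markov _ (trace_bmfun e n N) Z0 xp) _.
  rewrite lee_fin ler_pdivrMr // (le_trans mean_le) // -[leRHS]mulrA ler_wpM2l //.
  rewrite expRD -[leRHS]mulrA -[leLHS]mulr1.
  rewrite ler_wpM2l ?expR_ge0 //.
  rewrite -ler_pdivrMl ?expR_gt0 // mulr1 -expRN; exact: expR_le_1BX.
move=> w /= /negP; rewrite -ltNge => Zlt u; rewrite leNgt; apply/negP => ult.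
have q0 := bform1_ge0 u.
have h : (1 - x / N%:R) * moment (pencil e n w) u 0 <= moment (pencil e n w) u 1.
  rewrite /moment expr0 expr1 bform_pencil mulrBl mul1r lerD2l /e mulNr lerN2.
  have -> : x / N%:R = th / N%:R * (n%:R * t) by rewrite /x; field; rewrite gt_eqF.
  by rewrite -[leRHS]mulrA ler_wpM2l ?divr_ge0 // ltW.
have mge k := moment_ge0 u k (pP n w).
have mlc k := moment_lc u k (pP n w).
have := log_convex_geom mge mlc N _ h.
rewrite ltW // => /(_ isT); rewrite {1}/moment expr0 => H.
have := le_trans H (trace_psd_ge u (psdX N (pP n w))).
have [u0|un0] := eqVneq (bform 1 u u) 0.
  by move: ult; rewrite u0 mulr0 ltNge gram_sum_ge0.
have qp : 0 < bform 1 u u by rewrite lt_neqAle eq_sym un0.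
by rewrite mulrC ler_pM2l // leNgt Zlt.
Qed.

(* [theta = 2/3 min(eps, 1) / M] gives the exponent [16/9 L] as [N] tends to
   infinity; [7/4] leaves room for a finite [N]. *)
Lemma gram_upper_bound (eps L : R) : (0 < n)%N -> 0 < M -> 0 < eps -> 0 < L ->
  eps * Num.min eps 1 = 16 * M / (3 * n%:R) * L ->
  exists2 B, measurable B & (Pr B <= (r.+1%:R * expR (- (7 / 4 * L)))%:E)%E /\
    forall w, ~ B w -> forall u, bform (gram_sum n w) u u <= n%:R * (1 + eps) * bform 1 u u.
Proof.
move=> n0 M0 eps0 L0 epsE; have nR : 0 < n%:R :> R by rewrite ltr0n.
set e1 := Num.min eps 1 in epsE.
have e10 : 0 < e1 by rewrite lt_min eps0 ltr01.
have e11 : e1 <= 1 by rewrite ge_min lexx orbT.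
have e1eps : e1 <= eps by rewrite ge_min lexx.
pose th := 2 / 3 * e1 / M; have th0 : 0 <= th by rewrite divr_ge0 ?mulr_ge0 // ltW.
pose x := n%:R * th * (1 + eps).
have e20 : 0 <= 1 + eps by rewrite addr_ge0 // ltW.
have x0 : 0 <= x by apply: mulr_ge0 => //; exact: mulr_ge0.
(* The constant 36 makes x ^ 2 / N at most L / 36, and 1/36 = 16/9 - 7/4. *)
pose N := (Num.Def.archi_bound (36 * x ^+ 2 / L)).+1.
have NR : 0 < N%:R :> R by rewrite ltr0n.
have xN : x ^+ 2 / N%:R <= L / 36.
  have : 36 * x ^+ 2 / L <= N%:R.
    rewrite ltW // (lt_le_trans (archi_boundP _)) ?ler_nat ?leqnSn //.
    by apply: divr_ge0; [rewrite mulr_ge0 ?sqr_ge0 | exact: ltW].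
  by rewrite !ler_pdivrMr //; lra.
have [B mB [PB HB]] := gram_upper_tail (N := N) (ltn0Sn _) M0 th0 e20.
exists B => //; split=> //; apply: le_trans PB _; rewrite lee_fin ler_wpM2l // ler_expR.
have thM : th * M = 2 / 3 * e1 by rewrite /th; field; rewrite gt_eqF.
rewrite thM -/x.
(* Capping eps at 1 in [th] keeps th M in the range of the quadratic bound. *)
have hu : 0 <= 2 / 3 * e1 <= 2 / 3 by apply/andP; split; lra.
have hexp := expR_le_quadratic hu.
have h1 : n%:R * ((expR (2 / 3 * e1) - 1) / M) <=
          n%:R * ((2 / 3 * e1 + 3 / 4 * (2 / 3 * e1) ^+ 2) / M).
  rewrite ler_wpM2l // ler_wpM2r ?invr_ge0 ?(ltW M0) //; lra.
have h2 : n%:R * ((2 / 3 * e1 + 3 / 4 * (2 / 3 * e1) ^+ 2) / M) - x =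
    - (n%:R / M * (2 / 3 * (eps * e1) - e1 ^+ 2 / 3)).
  by rewrite /x /th; field; rewrite gt_eqF.
have h3 : n%:R / M * (eps * e1 / 3) <= n%:R / M * (2 / 3 * (eps * e1) - e1 ^+ 2 / 3).
  rewrite ler_wpM2l ?divr_ge0 ?(ltW M0) //; have : e1 * e1 <= eps * e1 by rewrite ler_wpM2r // ltW.
  rewrite expr2; lra.
have h4 : n%:R / M * (eps * e1 / 3) = 16 / 9 * L.
  by rewrite epsE; field; rewrite !gt_eqF.
lra.
Qed.

(* [theta = eps / M] gives the exponent [8/3 L] as [N] tends to infinity. *)
Lemma gram_lower_bound (eps L : R) : (0 < n)%N -> 1 <= M -> 0 < eps <= 1 -> 0 < L ->
  eps ^+ 2 = 16 * M / (3 * n%:R) * L ->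
  exists2 B, measurable B & (Pr B <= (r.+1%:R * expR (- (5 / 2 * L)))%:E)%E /\
    forall w, ~ B w -> forall u, n%:R * (1 - eps) * bform 1 u u <= bform (gram_sum n w) u u.
Proof.
move=> n0 M1 /andP[eps0 eps1] L0 epsE; have nR : 0 < n%:R :> R by rewrite ltr0n.
have M0 : 0 < M by exact: lt_le_trans M1.
pose th := eps / M; have th0 : 0 <= th by rewrite divr_ge0 // ltW.
have thM : th * M = eps by rewrite /th; field; rewrite gt_eqF.
have th1 : th <= 1 by rewrite ler_pdivrMr // mul1r; lra.
pose y := n%:R * th * (1 - eps).
have e10 : 0 <= 1 - eps by rewrite subr_ge0.
have y0 : 0 <= y by apply: mulr_ge0 => //; exact: mulr_ge0.
(* [C1] / N collects the terms of order 1 / N in the exponent. The threshold [b] brings them below L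
   / 6, where 1/6 = 8/3 - 5/2, and also ensures the two size conditions on N. *)
pose C1 := n%:R ^+ 2 * th ^+ 3 * M ^+ 2 + 2 * y ^+ 2.
have C10 : 0 <= C1.
  apply: addr_ge0; last by apply: mulr_ge0 => //; exact: sqr_ge0.
  apply: mulr_ge0; last exact: sqr_ge0.
  by apply: mulr_ge0; [exact: sqr_ge0 | exact: exprn_ge0].
pose b := 2 * y + 2 * (n%:R * eps) + 6 * C1 / L.
have b1 : 0 <= 2 * y by rewrite mulr_ge0.
have b2 : 0 <= 2 * (n%:R * eps) by do 2?apply: mulr_ge0 => //; exact: ltW.
have b3 : 0 <= 6 * C1 / L by apply: divr_ge0; [exact: mulr_ge0 | exact: ltW].
pose K := (Num.Def.archi_bound b).+1.
have bN : b <= K.*2.+1%:R.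
  rewrite ltW // (lt_le_trans (archi_boundP _)) ?addr_ge0 // ler_nat.
  by apply: leq_trans (leqnSn _) _; rewrite -/K -addnn leqW ?leq_addr.
have NR : 0 < K.*2.+1%:R :> R by rewrite ltr0n.
have N1 : 2 * (n%:R * th * (1 - eps)) <= K.*2.+1%:R.
  by rewrite -/y; apply: le_trans bN; rewrite /b; lra.
have N2 : 2 * (n%:R * th * M) <= K.*2.+1%:R.
  by rewrite -mulrA thM; apply: le_trans bN; rewrite /b; lra.
have N3 : C1 / K.*2.+1%:R <= L / 6.
  have : 6 * C1 / L <= K.*2.+1%:R by apply: le_trans bN; rewrite /b; lra.
  by rewrite !ler_pdivrMr //; lra.
have th01 : 0 <= th <= 1 by rewrite th0 th1.
have thM1 : th * M <= 1 by rewrite thM.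
have [B mB [PB HB]] := gram_lower_tail (ltn0Sn _) M0 th01 thM1 e10 N1 N2.
exists B => //; split=> //; apply: le_trans PB _; rewrite lee_fin ler_wpM2l // ler_expR.
rewrite -/y; set N := K.*2.+1%:R in N3 NR *.
have -> : - (n%:R * (th - th ^+ 2 * M / 2 * (1 + 2 * (n%:R * th * M / N)))) +
    (y + 2 * y ^+ 2 / N) = - (n%:R * eps ^+ 2 / (2 * M)) + C1 / N.
  by rewrite /C1 /y /th; field; rewrite !gt_eqF.
have -> : n%:R * eps ^+ 2 / (2 * M) = 8 / 3 * L.
  by rewrite epsE; field; rewrite !gt_eqF.
move: N3; move: (C1 / N) => c ?; lra.
Qed.

Lemma gram_concentration (eps L : R) : (0 < n)%N -> 1 <= M -> 0 < eps -> 0 < L ->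
  eps * Num.min eps 1 = 16 * M / (3 * n%:R) * L ->
  exists2 B, measurable B &
    (Pr B <= (r.+1%:R * (expR (- (7 / 4 * L)) + expR (- (5 / 2 * L))))%:E)%E /\
    forall w, ~ B w -> forall u,
      n%:R * (1 - eps) * bform 1 u u <= bform (gram_sum n w) u u
        <= n%:R * (1 + eps) * bform 1 u u.
Proof.
move=> n0 M1 eps0 L0 epsE; have M0 : 0 < M by exact: lt_le_trans M1.
have [B mB [PB HB]] := gram_upper_bound n0 M0 eps0 L0 epsE.
have [B' mB' [PB' HB']] : exists2 B, measurable B &
    (Pr B <= (r.+1%:R * expR (- (5 / 2 * L)))%:E)%E /\
    forall w, ~ B w -> forall u, n%:R * (1 - eps) * bform 1 u u <= bform (gram_sum n w) u u.
  (* For eps > 1 the lower bound is nonpositive and the empty event suffices. *)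
  have [eps1|eps1] := leP eps 1.
    apply: gram_lower_bound => //; first by rewrite eps0.
    by rewrite -epsE min_l // expr2.
  exists set0 => //; split; first by rewrite measure0 lee_fin mulr_ge0 // expR_ge0.
  move=> w _ u; rewrite (le_trans _ (gram_sum_ge0 _ _ _)) //.
  by rewrite mulr_le0_ge0 ?bform1_ge0 // mulr_ge0_le0 // subr_le0 ltW.
exists (B `|` B'); first exact: measurableU.
split.
  rewrite (le_trans (measureU2 _ _ _)) //.
  by rewrite mulrDr EFinD leeD.
by move=> w /not_orP[nB nB'] u; rewrite HB' ?HB.
Qed.

End matrix_chernoff.

(** * Polynomials on the support *)

Section polynomial_values.
Context (R : realType) (p : nat).
Implicit Types (P Q : mvpoly R p) (x : 'rV[R]_p).

Lemma pvalD P Q x : pval (P + Q) x = pval P x + pval Q x.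
Proof. exact: mpoly.mevalD. Qed.

Lemma pvalZ c P x : pval (c *: P) x = c * pval P x.
Proof. exact: mpoly.mevalZ. Qed.

Lemma pval_sum (I : Type) (s : seq I) (F : I -> mvpoly R p) x :
  pval (\sum_(i <- s) F i) x = \sum_(i <- s) pval (F i) x.
Proof. exact: raddf_sum. Qed.

Lemma pval_monomials P x :
  pval P x = \sum_(m <- mpoly.msupp P) mpoly.mcoeff m P * \prod_i x ord0 i ^+ m i.
Proof. exact: mpoly.mevalE. Qed.

Lemma PiD (d : nat) P Q : Pi d P -> Pi d Q -> Pi d (P + Q).
Proof.
move=> hP hQ; rewrite /Pi /=.
by rewrite (leq_trans (mpoly.msizeD_le _ _)) // geq_max hP hQ.
Qed.

Lemma PiZ (d : nat) c P : Pi d P -> Pi d (c *: P).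
Proof. by move=> hP; exact: leq_trans (mpoly.msizeZ_le _ _) hP. Qed.

Lemma Pi0 (d : nat) : Pi d (0 : mvpoly R p).
Proof. by rewrite /Pi /= mpoly.mmeasure0. Qed.

Lemma Pi_sum (I : Type) (s : seq I) d (F : I -> mvpoly R p) :
  (forall i, Pi d (F i)) -> Pi d (\sum_(i <- s) F i).
Proof. by move=> hF; apply: big_ind => //; [exact: Pi0 | exact: PiD]. Qed.

Lemma pval_continuous P : continuous (pval P).
Proof.
have cC (c : R) : continuous (fun _ : 'rV[R]_p => c) by exact: cst_continuous.
have cM (f g : 'rV[R]_p -> R) : continuous f -> continuous g ->
    continuous (fun x => f x * g x).
  by move=> cf cg x; exact: cvgM (cf x) (cg x).
rewrite (_ : pval P = fun x => \sum_(m <- mpoly.msupp P)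
    mpoly.mcoeff m P * \prod_i x ord0 i ^+ m i); last first.
  by apply/funext => x; exact: pval_monomials.
elim: (mpoly.msupp P) => [|m s IHs].
  by under eq_fun do rewrite big_nil; exact: cC.
under eq_fun do rewrite big_cons.
move=> x; apply: (cvgD _ (IHs x)); move: x; apply: (cM); first exact: cC.
elim: (index_enum _) => [|i r IHr].
  by under eq_fun do rewrite big_nil; exact: cC.
under eq_fun do rewrite big_cons.
apply: (cM) => //; elim: (m i) => [|k IHk].
  by under eq_fun do rewrite expr0; exact: cC.
under eq_fun do rewrite exprS.
by apply: (cM) => //; exact: coord_continuous.
Qed.

Lemma continuous_borel (f : 'rV[R]_p -> R) : continuous f ->
  measurable_fun setT (f : borelRn R p -> R).
Proof.
move=> /continuousP cf; apply: (measurability _ (RGenOpens.measurableE R)).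
move=> _ [_ [a [b ->]] <-]; rewrite setTI.
by apply: sub_sigma_algebra; apply: cf; exact: interval_open.
Qed.

(* Restrict to a line through a point of the open set and count roots. *)
Lemma pval_eq0 P (A : set 'rV[R]_p) : A^° !=set0 ->
  (forall x, A x -> pval P x = 0) -> forall x, pval P x = 0.
Proof.
move=> [x0 /nbhs_ballP[e /= e0 xA]] PA x.
pose g : {poly R} := \sum_(m <- mpoly.msupp P) (mpoly.mcoeff m P)%:P *
  \prod_i ((x0 ord0 i)%:P + (x ord0 i - x0 ord0 i)%:P * 'X) ^+ m i.
have gE t : g.[t] = pval P (x0 + t *: (x - x0)).
  rewrite pval_monomials horner_sum; apply: eq_bigr => m _.
  rewrite hornerM hornerC horner_prod; congr (_ * _); apply: eq_bigr => i _.
  by rewrite horner_exp hornerD hornerM !hornerC hornerX !mxE mulrC.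
have -> : pval P x = g.[1] by rewrite gE scale1r addrC subrK.
suff -> : g = 0 by rewrite horner0.
(* [D] dominates every coordinate of x - x0, so x0 + t (x - x0) stays in the ball when t D < e. *)
pose D := 1 + \sum_i `|x ord0 i - x0 ord0 i|.
have D0 : 0 < D by rewrite ltr_pwDl // sumr_ge0.
have small t : 0 < t -> t * D < e -> root g t.
  move=> t0 tD; apply/eqP; rewrite gE; apply: PA; apply: xA; split=> // i j.
  rewrite ord1 /ball /= !mxE opprD addrA subrr add0r normrN normrM gtr0_norm //.
  apply: le_lt_trans tD; rewrite ler_wpM2l ?(ltW t0) // /D (bigD1 j) //=.
  by rewrite addrCA lerDl addr_ge0 // sumr_ge0.
apply/eqP/negPn/negP => g0.
(* These are [size g] distinct roots, one more than the degree; starting the denominators at 2 keeps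
   them strictly below e / D. *)
pose s := [seq e / D / k.+2%:R | k <- iota 0 (size g)].
have := @max_poly_roots _ g s g0; rewrite size_map size_iota ltnn => h.
suff : false by []; apply: h.
  apply/allP => t /mapP[k _ ->].
  have eD : 0 < e / D by rewrite divr_gt0.
  apply: small; first by rewrite divr_gt0.
  by rewrite mulrAC divfK ?gt_eqF // ltr_pdivrMr // ltr_pMr // ltr1n.
rewrite map_inj_uniq ?iota_uniq // => k l /mulfI.
have eD : e / D != 0 by rewrite gt_eqF // divr_gt0.
by move=> /(_ eD) /invr_inj /eqP; rewrite eqr_nat => /eqP [].
Qed.

End polynomial_values.

(** * Support of a probability measure *)

Section support.
Context (R : realType) (p : nat) (mu : probability (borelRn R p) R).
Local Notation S := (measure_support mu).

Lemma support_closed : closed S.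
Proof.
move=> x Sx U oU Ux; have [y [Sy Uy]] := Sx _ (open_nbhs_nbhs (conj oU Ux)).
exact: Sy.
Qed.

Lemma open_borel (U : set 'rV[R]_p) : open U -> measurable (U : set (borelRn R p)).
Proof. by move=> oU; exact: sub_sigma_algebra. Qed.

Lemma support_measurable : measurable (S : set (borelRn R p)).
Proof.
rewrite -[S]setCK; apply: measurableC; apply: open_borel.
exact: (closed_openC support_closed).
Qed.

(* The complement of the support is covered by countably many null balls with
   rational centers and radii. *)
Lemma support_full : mu (~` S) = 0%E.
Proof.
apply: measure_negligible; first exact: measurableC support_measurable.
pose B (i : 'rV[rat]_p * nat) : set 'rV[R]_p :=
  (ball (\row_j ratr (i.1 ord0 j) : 'rV[R]_p) (i.2.+1%:R^-1))^°.
pose F (k : nat) : set (borelRn R p) :=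
  if unpickle k is Some i then (if mu (B i) == 0%E then B i else set0) else set0.
apply: (@negligibleS _ _ _ _ (\bigcup_k F k)); last first.
  apply: negligible_bigcup => k; rewrite /F.
  case: (unpickle k) => [i|]; last exact: negligible_set0.
  case: eqP => [Bi|_]; last exact: negligible_set0.
  by apply/negligibleP => //; apply: open_borel; exact: open_interior.
move=> x /existsNP[U /not_implyP[oU /not_implyP[Ux nU]]].
have /nbhs_ballP[e /= e0 xU] := open_nbhs_nbhs (conj oU Ux).
(* Two radii 1 / (k + 1) fit into e, so a ball of that radius that contains x lies in U. *)
pose k := Num.Def.archi_bound (2 / e).
have ke : 2 * k.+1%:R^-1 < e.
  have : 2 / e < k.+1%:R.
    rewrite (lt_le_trans (archi_boundP _)) ?ler_nat //.
    by rewrite divr_ge0 // ltW.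
  by rewrite ltr_pdivrMr // ltr_pdivrMr // mulrC.
set d := k.+1%:R^-1 in ke; have d0 : 0 < d by rewrite invr_gt0.
have /choice[q qx] : forall j, exists q : rat, `|x ord0 j - ratr q| < d / 2.
  move=> j; have h : x ord0 j - d / 2 < x ord0 j + d / 2 by lra.
  have [q] := rat_in_itvoo h; rewrite in_itv /= => /andP[q1 q2].
  by exists q; rewrite ltr_norml; apply/andP; split; lra.
pose i : 'rV[rat]_p * nat := (\row_j q j, k).
have Bx : B i x.
  rewrite /B /interior; apply/nbhs_ballP; exists (d / 2); first by rewrite /= divr_gt0.
  move=> y [_ xy]; split=> // a j; rewrite !mxE !ord1 -/d.
  have := xy 0 j; rewrite /ball /= => xyj; have := qx j => qxj.
  rewrite /ball /= distrC (_ : y 0 j - _ = (y 0 j - x 0 j) + (x 0 j - ratr (q j))); last by ring.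
  rewrite (le_lt_trans (ler_normD _ _)) // [`|y 0 j - _|]distrC.
  by rewrite [ltRHS](splitr d) ltrD.
have BU : B i `<=` U.
  move=> y /interior_subset [_ By]; apply: xU; split=> // a j; rewrite ord1.
  have := By 0 j; rewrite /ball /= !mxE => yj; have := qx j => qxj.
  rewrite (_ : x 0 j - _ = (x 0 j - ratr (q j)) + (ratr (q j) - y 0 j)); last by ring.
  rewrite (le_lt_trans (ler_normD _ _)) // (lt_trans _ ke) // mulr_natl mulr2n ltrD //.
  by rewrite (lt_trans qxj) // ltr_pdivrMr // ltr_pMr // ltr1n.
exists (pickle i) => //; rewrite /F pickleK.
case: eqP => // nB; exfalso; apply: nB; apply/eqP.
rewrite -measure_le0; apply: (@le_trans _ _ (mu U)); last by rewrite leNgt; apply/negP.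
by apply: le_measure; rewrite ?inE; [apply: open_borel; exact: open_interior | exact: open_borel | ].
Qed.

End support.

(** * Inner product and orthonormal polynomials *)

Section orthonormal_polynomials.
Context (R : realType) (p : nat) (mu : probability (borelRn R p) R).
Local Notation S := (measure_support mu).
Hypothesis S_compact : compact S.
Hypothesis S_interior : S^° !=set0.
Implicit Types P Q : mvpoly R p.

(** Truncation to the compact support makes a polynomial bounded on the whole space and changes it
    only on a null set. *)
Definition supp_pval P (x : borelRn R p) : R := pval P x * \1_S x.

Lemma bmfun_supp_pval P : bmfun (supp_pval P).
Proof.
have mS := support_measurable mu.
split.
  apply: measurable_funM; last exact: measurable_indic.
  exact: continuous_borel (@pval_continuous R p P).
have cP := continuous_subspaceT (@pval_continuous R p P).
have /compact_bounded[M [_ HM]] := continuous_compact (cP S) S_compact.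
exists (`|M| + 1) => x; rewrite /supp_pval indicE.
have [Sx|nSx] := pselect (S x).
  rewrite mem_set // mulr1; apply: (HM (`|M| + 1)); last by exists x.
  by rewrite ltr_pwDr // ler_norm.
by rewrite memNset // mulr0 normr0 addr_ge0.
Qed.

Lemma poly_innerE P Q :
  poly_inner mu P Q = mean mu (fun x => supp_pval P x * supp_pval Q x).
Proof.
have mP T : measurable_fun setT (fun x : borelRn R p => pval T x).
  exact: continuous_borel (@pval_continuous R p T).
have mS := support_measurable mu.
congr fine; apply: ae_eq_integral => //.
- by apply/measurable_EFinP; exact: measurable_funM.
- by apply/measurable_EFinP; case: (bmfunM (bmfun_supp_pval P) (bmfun_supp_pval Q)).
exists (~` S); split; first exact: measurableC.
  exact: support_full.
move=> x /= h Sx; apply: h => _.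
by rewrite /supp_pval indicE mem_set // !mulr1.
Qed.

Lemma poly_innerD P Q T : poly_inner mu (P + Q) T = poly_inner mu P T + poly_inner mu Q T.
Proof.
rewrite !poly_innerE -meanD; [|exact: bmfunM (bmfun_supp_pval _) (bmfun_supp_pval _)..].
by congr mean; apply/funext => x; rewrite /supp_pval pvalD; ring.
Qed.

Lemma poly_innerZ c P T : poly_inner mu (c *: P) T = c * poly_inner mu P T.
Proof.
rewrite !poly_innerE -meanZ; last exact: bmfunM (bmfun_supp_pval _) (bmfun_supp_pval _).
by congr mean; apply/funext => x; rewrite /supp_pval pvalZ; ring.
Qed.

Lemma poly_innerC P T : poly_inner mu P T = poly_inner mu T P.
Proof. by rewrite !poly_innerE; congr mean; apply/funext => x; rewrite mulrC. Qed.

Lemma poly_inner_sum (I : Type) (s : seq I) (F : I -> mvpoly R p) T :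
  poly_inner mu (\sum_(i <- s) F i) T = \sum_(i <- s) poly_inner mu (F i) T.
Proof.
elim: s => [|i s IHs]; last by rewrite !big_cons poly_innerD IHs.
by rewrite !big_nil -[0]addr0 -(scale0r 0) poly_innerD poly_innerZ mul0r addr0.
Qed.

Lemma poly_inner_ge0 P : 0 <= poly_inner mu P P.
Proof. by rewrite poly_innerE mean_ge0 // => x; rewrite -expr2 sqr_ge0. Qed.

(** Near a support point where P is nonzero, |P| > c / 2 on an open set of positive mass, whereas
    Markov's inequality with zero norm makes that set null. So P vanishes on the support, which has
    interior. *)
Lemma poly_inner_eq0 P : poly_inner mu P P = 0 -> forall x, pval P x = 0.
Proof.
move=> P0; apply: pval_eq0 S_interior _ => x0 Sx0.
apply/eqP/negPn/negP => Px0.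
pose c := `|pval P x0|; have c0 : 0 < c by rewrite normr_gt0.
pose U := (pval P) @^-1` [set y | (c / 2 < `|y|)%R].
have oU : open U.
  have /continuousP := @pval_continuous R p P; apply.
  have /continuousP nc : continuous (fun y : R => `|y|) by exact: norm_continuous.
  exact: nc _ (@open_gt R (c / 2)).
have Ux0 : U x0 by rewrite /U /= -/c ltr_pdivrMr // ltr_pMr // ltr1n.
have := Sx0 U oU Ux0; apply/negP; rewrite -leNgt.
have bP := bmfun_supp_pval P; have bP2 := bmfunM bP bP.
have t0 : 0 < (c / 2) ^+ 2 by rewrite exprn_gt0 // divr_gt0.
have sq x : 0 <= supp_pval P x * supp_pval P x by rewrite -expr2 sqr_ge0.
have := mean_markov mu bP2 sq t0; rewrite -poly_innerE P0 mul0r => h.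
have mS := support_measurable mu; have mU := open_borel oU.
have mA := bmfun_superlevel ((c / 2) ^+ 2) bP2.
apply: (@le_trans _ _ (mu ([set x | (c / 2) ^+ 2 <= supp_pval P x * supp_pval P x] `|` ~` S))).
  apply: le_measure; rewrite ?inE //; first by apply: measurableU => //; exact: measurableC.
  move=> x Ux; have [Sx|nSx] := pselect (S x); [left | by right].
  rewrite /= /supp_pval indicE mem_set // mulr1 -expr2 -[leRHS]real_normK ?num_real //.
  by rewrite lerXn2r ?nnegrE ?divr_ge0 // ltW.
rewrite (le_trans (measureU2 _ _ _)) //; first exact: measurableC.
rewrite -[leRHS]add0e; apply: leeD; first exact: h.
by have := lexx (0%E : \bar R); rewrite -{1}(support_full mu).
Qed.

(** A generator whose remainder has zero norm is dropped, hence only an inequality between the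
    sizes. Spanning is stated for values, since vanishing values are what [poly_inner_eq0]
    provides. *)
Lemma gram_schmidt (d : nat) (gens : seq (mvpoly R p)) :
  (forall g, g \in gens -> Pi d g) ->
  exists qs : seq (mvpoly R p),
  [/\ (size qs <= size gens)%N,
      forall q, q \in qs -> Pi d q,
      forall i j, (i < size qs)%N -> (j < size qs)%N ->
        poly_inner mu (nth 0 qs i) (nth 0 qs j) = (i == j)%:R &
      forall g, g \in gens -> exists c : nat -> R, forall x,
        pval g x = \sum_(i < size qs) c i * pval (nth 0 qs i) x].
Proof.
elim: gens => [|g gens IHg] hg; first by exists [::]; split.
have [|qs [sz Pq on sp]] := IHg; first by move=> h hh; apply: hg; rewrite inE hh orbT.
have Pnth i : Pi d (nth 0 qs i).
  by have [iq|iq] := ltnP i (size qs); [exact/Pq/mem_nth | rewrite nth_default //; exact: Pi0].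
pose r := g - \sum_(i < size qs) poly_inner mu g (nth 0 qs i) *: nth 0 qs i.
have gE x : pval g x = pval r x + \sum_(i < size qs) poly_inner mu g (nth 0 qs i) * pval (nth 0 qs i) x.
  rewrite -{1}(subrK (\sum_(i < size qs) poly_inner mu g (nth 0 qs i) *: nth 0 qs i) g).
  rewrite pvalD pval_sum; congr (_ + _); apply: eq_bigr => i _; exact: pvalZ.
have Pr : Pi d r.
  rewrite /r -scaleN1r; apply: PiD; first by apply: hg; rewrite inE eqxx.
  by apply/PiZ/Pi_sum => i; exact: PiZ.
have rq j : (j < size qs)%N -> poly_inner mu r (nth 0 qs j) = 0.
  move=> jq; rewrite /r -scaleN1r poly_innerD poly_innerZ poly_inner_sum.
  rewrite (bigD1 (Ordinal jq)) //= big1 => [|i ij].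
    by rewrite poly_innerZ on // eqxx mulr1 addr0 mulN1r subrr.
  rewrite poly_innerZ on // (_ : (i == j :> nat) = false) ?mulr0 //.
  by apply/negbTE; apply: contra ij => /eqP e; apply/eqP/val_inj.
have [r0|rn0] := eqVneq (poly_inner mu r r) 0.
  exists qs; split=> //; first exact: leqW.
  move=> h; rewrite inE => /orP[/eqP ->|/sp //].
  exists (fun i => poly_inner mu g (nth 0 qs i)) => x.
  by rewrite gE (poly_inner_eq0 r0) add0r.
have rp : 0 < poly_inner mu r r by rewrite lt_neqAle eq_sym rn0 poly_inner_ge0.
pose a := Num.sqrt (poly_inner mu r r).
have a0 : 0 < a by rewrite sqrtr_gt0.
pose q := a^-1 *: r.
have qj j : (j < size qs)%N -> poly_inner mu q (nth 0 qs j) = 0.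
  by move=> jq; rewrite poly_innerZ rq // mulr0.
exists (q :: qs); split.
- by rewrite /= ltnS.
- by move=> h; rewrite inE => /orP[/eqP ->|/Pq //]; exact: PiZ.
- move=> [|i] [|j] //= iq jq.
  + rewrite poly_innerZ poly_innerC poly_innerZ -(sqr_sqrtr (ltW rp)) -/a.
    by field; rewrite gt_eqF.
  + by rewrite qj.
  + by rewrite poly_innerC qj.
  + by rewrite on // eqSS.
move=> h; rewrite inE => /orP[/eqP ->|/sp [c hc]].
  exists (fun i => if i is i'.+1 then poly_inner mu g (nth 0 qs i') else a) => x.
  rewrite /= big_ord_recl /= gE pvalZ mulrA mulfV ?mul1r //.
  by rewrite gt_eqF.
exists (fun i => if i is i'.+1 then c i' else 0) => x.
by rewrite /= big_ord_recl /= mul0r add0r hc.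
Qed.

(** Exponents in degree at most d are themselves at most d, so the monomials are coded by tuples
    over a finite type and can be counted. *)
Definition monomial_of d (t : p.-tuple 'I_d.+1) : mpoly.multinom p :=
  mpoly.Multinom [tuple nat_of_ord (tnth t i) | i < p].

Lemma mdeg_monomial_of d (t : p.-tuple 'I_d.+1) :
  mpoly.mdeg (monomial_of t) = (\sum_(i <- t) i)%N.
Proof.
by rewrite /mpoly.mdeg !big_tuple; apply: eq_bigr => i _; rewrite tnth_mktuple.
Qed.

(** The basis is nonempty because the constant 1 is spanned. Its size is bounded by the number s(d)
    of monomials; the bound suffices because the dimension enters the tails as a factor. *)
Lemma orthonormal_basis (d : nat) :
  exists (r : nat) (q : 'I_r.+1 -> mvpoly R p),
  [/\ (r < sdim p d)%N,
      forall k, Pi d (q k),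
      forall k l, poly_inner mu (q k) (q l) = (k == l)%:R &
      forall P, Pi d P -> exists c : 'I_r.+1 -> R, forall x,
        pval P x = \sum_k c k * pval (q k) x].
Proof.
pose A := [set t : p.-tuple 'I_d.+1 | (\sum_(i <- t) i <= d)%N]%SET.
pose gens : seq (mvpoly R p) := [seq mpoly.mpolyX R (monomial_of t) | t <- enum A].
have szg : size gens = sdim p d.
  rewrite size_map -cardE card_partial_ord_partitions /sdim -[RHS]bin_sub ?leq_addr //.
  by rewrite addKn addnC.
have gensP g : g \in gens -> Pi d g.
  move=> /mapP[t]; rewrite mem_enum inE -mdeg_monomial_of => tA ->.
  by rewrite /Pi /= mpoly.mmeasureX ltnS.
have [qs [sz Pq on sp]] := gram_schmidt gensP.
have span P : Pi d P -> exists c : nat -> R, forall x,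
    pval P x = \sum_(i < size qs) c i * pval (nth 0 qs i) x.
  move=> PiP.
  have /choice[c cE] : forall m : mpoly.multinom p, exists c : nat -> R,
      m \in mpoly.msupp P -> forall x : 'rV[R]_p, \prod_i x ord0 i ^+ m i =
        \sum_(i < size qs) c i * pval (nth 0 qs i) x.
    move=> m; have [mP|_] := boolP (m \in mpoly.msupp P); last by exists (fun _ => 0).
    have md : (mpoly.mdeg m <= d)%N.
      by rewrite -ltnS (leq_trans (mpoly.msize_mdeg_lt mP)).
    have mle i : (m i <= d)%N.
      apply: leq_trans md; rewrite mpoly.mdegE (bigD1 i) //=; exact: leq_addr.
    pose t : p.-tuple 'I_d.+1 := [tuple inord (m i) | i < p].
    have mt : monomial_of t = m.
      by apply/mpoly.mnmP => i; rewrite mpoly.multinomE !tnth_mktuple inordK ?ltnS.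
    have [|c cE] := sp (mpoly.mpolyX R m).
      by rewrite -mt; apply: map_f; rewrite mem_enum inE -mdeg_monomial_of mt.
    exists c => _ x; rewrite -cE; symmetry; exact: mpoly.mevalX.
  exists (fun k => \sum_(m <- mpoly.msupp P) mpoly.mcoeff m P * c m k) => x.
  rewrite pval_monomials; under [RHS]eq_bigr do rewrite mulr_suml.
  rewrite exchange_big /=; apply: eq_big_seq => m mP.
  rewrite cE // mulr_sumr; apply: eq_bigr => i _; exact: mulrA.
have Pi1 : Pi d (1 : mvpoly R p) by rewrite /Pi /= mpoly.mmeasure1.
case: (size qs) sz on span (fun i => mem_nth 0 (s := qs) (n := i)) => [|r] sz on span qsP.
  have [c /(_ 0)] := span 1 Pi1; rewrite big_ord0.
  by move/eqP; rewrite /pval mpoly.meval1 oner_eq0.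
exists r, (fun k => nth 0 qs k); split.
- by rewrite -szg.
- by move=> k; exact/Pq/qsP.
- by move=> k l; rewrite on.
- by move=> P /span[c cE]; exists (fun k => c k).
Qed.

End orthonormal_polynomials.

(** * Christoffel functions *)

Section christoffel_comparison.
Context (R : realType) (p : nat).
Implicit Types (P Q T : mvpoly R p).

Lemma poly_inner_ext (nu : {measure set (borelRn R p) -> \bar R}) P Q P' Q' :
  (forall x, pval P x = pval P' x) -> (forall x, pval Q x = pval Q' x) ->
  poly_inner nu P Q = poly_inner nu P' Q'.
Proof. by move=> PP' QQ'; apply: eq_Rintegral => x _; rewrite PP' QQ'. Qed.

(** On measurable sets the empirical measure is a scaled finite sum of Dirac masses, which is
    integrated term by term. *)
Lemma poly_inner_empirical n (y : 'I_n -> borelRn R p) P :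
  poly_inner (empirical_measure R y) P P = n%:R^-1 * \sum_i pval P (y i) ^+ 2.
Proof.
pose D (k : nat) : {measure set (borelRn R p) -> \bar R} :=
  if insub k is Some i then (\d_(y i) : {measure set (borelRn R p) -> \bar R}) else mzero.
pose f := fun x : borelRn R p => (pval P x * pval P x)%:E.
have mf : measurable_fun setT f.
  apply/measurable_EFinP; apply: measurable_funM;
  exact: continuous_borel (@pval_continuous R p P).
have f0 x : setT x -> (0 <= f x)%E by move=> _; rewrite lee_fin -expr2 sqr_ge0.
have -> : poly_inner (empirical_measure R y) P P =
    fine (\int[mscale ((n%:R^-1)%:nng : {nonneg R})%R (msum D n)]_x f x)%E.
  congr fine; apply: eq_measure_integral => A mA _ /=.
  rewrite /empirical_measure /mscale /msum /=; congr (_ * _)%E.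
  by apply: eq_bigr => i _; rewrite /D valK.
rewrite ge0_integral_mscale // ge0_integral_measure_sum //=.
rewrite (_ : (\sum_(i < n) \int[D i]_x f x)%E = (\sum_i pval P (y i) ^+ 2)%:E) //.
rewrite -sumEFin; apply: eq_bigr => i _.
rewrite /D valK integral_dirac // diracT mul1e /f expr2 //.
Qed.

Lemma Pi_one d : exists2 P : mvpoly R p, Pi d P & forall x, pval P x = 1.
Proof.
exists (1 : mvpoly R p); first by rewrite /Pi /= mpoly.mmeasure1.
by move=> x; exact: mpoly.meval1.
Qed.

(** Both infima run over the same polynomials, so the comparison of the quadratic forms passes to
    them. *)
Lemma christoffel_compare (mu nu : {measure set (borelRn R p) -> \bar R}) d eps z :
  0 <= eps ->
  (forall P, Pi d P -> 0 <= poly_inner mu P P) ->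
  (forall P, Pi d P -> 0 <= poly_inner nu P P) ->
  (forall P, Pi d P -> (1 - eps) * poly_inner mu P P <= poly_inner nu P P
     <= (1 + eps) * poly_inner mu P P) ->
  `|christoffel mu d z - christoffel nu d z| <= christoffel mu d z * eps.
Proof.
move=> e0 mu0 nu0 H.
have ne (m : {measure set (borelRn R p) -> \bar R}) :
    [set poly_inner m P P | P in [set P | Pi d P /\ pval P z = 1]] !=set0.
  by have [P PP P1] := Pi_one d; exists (poly_inner m P P); exists P.
have lb (m : {measure set (borelRn R p) -> \bar R}) (h : forall P, Pi d P -> 0 <= poly_inner m P P) :
    lbound [set poly_inner m P P | P in [set P | Pi d P /\ pval P z = 1]] 0.
  by move=> _ [P [PP _] <-]; exact: h.
have le (m : {measure set (borelRn R p) -> \bar R}) (h : forall P, Pi d P -> 0 <= poly_inner m P P) P :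
    Pi d P -> pval P z = 1 -> christoffel m d z <= poly_inner m P P.
  by move=> PP P1; apply: ge_inf; [exists 0; exact: lb | exists P].
have mc0 : 0 <= christoffel mu d z by apply: lb_le_inf => //; exact: lb.
have nc0 : 0 <= christoffel nu d z by apply: lb_le_inf => //; exact: lb.
have e1 : 0 < 1 + eps by rewrite ltr_pwDl.
have up : christoffel nu d z <= (1 + eps) * christoffel mu d z.
  rewrite mulrC -ler_pdivrMr //; apply: lb_le_inf => // _ [P [PP P1] <-].
  rewrite ler_pdivrMr // mulrC; have /andP[_] := H P PP.
  exact/le_trans/le.
have lo : (1 - eps) * christoffel mu d z <= christoffel nu d z.
  apply: lb_le_inf => // _ [P [PP P1] <-].
  (* A negative factor 1 - eps reverses inequalities, but then the left-hand side is nonpositive. *)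
  have [e2|e2] := leP 0 (1 - eps).
    have /andP[h _] := H P PP; apply: le_trans h.
    by rewrite ler_wpM2l // le.
  by rewrite (@le_trans _ _ 0) ?nu0 // mulr_le0_ge0 // ltW.
by rewrite ler_norml; apply/andP; split; lra.
Qed.

End christoffel_comparison.

(** * Diagonal of the Christoffel-Darboux kernel *)

Section kernel_diagonal.
Context (R : realType) (p : nat) (mu : probability (borelRn R p) R).
Local Notation S := (measure_support mu).
Hypothesis S_compact : compact S.
Hypothesis S_interior : S^° !=set0.
Variables (d r : nat) (q : 'I_r.+1 -> mvpoly R p).
Hypothesis Pi_q : forall k, Pi d (q k).
Hypothesis q_on : forall k l, poly_inner mu (q k) (q l) = (k == l)%:R.
Hypothesis q_span : forall P, Pi d P -> exists c : 'I_r.+1 -> R, forall x,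
  pval P x = \sum_k c k * pval (q k) x.

Lemma poly_inner_basis (P : mvpoly R p) (c : 'I_r.+1 -> R) l :
  (forall x, pval P x = \sum_k c k * pval (q k) x) ->
  poly_inner mu P (q l) = c l.
Proof.
move=> Pc; rewrite (@poly_inner_ext _ _ _ P (q l) (\sum_k c k *: q k) (q l)) //; last first.
  by move=> x; rewrite Pc pval_sum; apply: eq_bigr => k _; rewrite pvalZ.
rewrite poly_inner_sum // (bigD1 l) //= poly_innerZ // q_on eqxx mulr1 big1 ?addr0 //.
by move=> k kl; rewrite poly_innerZ // q_on (negbTE kl) mulr0.
Qed.

Lemma poly_inner_parseval (P : mvpoly R p) (c : 'I_r.+1 -> R) :
  (forall x, pval P x = \sum_k c k * pval (q k) x) ->
  poly_inner mu P P = \sum_k c k ^+ 2.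
Proof.
move=> Pc; rewrite (@poly_inner_ext _ _ _ P P (\sum_k c k *: q k) P) //; last first.
  by move=> x; rewrite Pc pval_sum; apply: eq_bigr => k _; rewrite pvalZ.
rewrite poly_inner_sum //; apply: eq_bigr => k _.
by rewrite poly_innerZ // poly_innerC // (poly_inner_basis _ Pc).
Qed.

(** The basis expansion is a reproducing kernel, so [xget] does not return its default value; the
    reproducing property then forces the coefficients of the selected kernel at x to be the values q
    k x. *)
Lemma CD_kernel_diag x : CD_kernel mu d x x = \sum_k pval (q k) x ^+ 2.
Proof.
have KK : reproducing_kernel mu d (CD_kernel mu d).
  apply: (xgetPex (fun _ _ => 0)); exists (fun x y => \sum_k pval (q k) x * pval (q k) y).
  move=> y; exists (\sum_k pval (q k) y *: q k); split.
  - by apply: Pi_sum => k; exact: PiZ.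
  - by apply/funext => z; rewrite pval_sum; apply: eq_bigr => k _; rewrite pvalZ.
  move=> P /q_span[c Pc]; rewrite poly_innerC // poly_inner_sum // Pc.
  apply: eq_bigr => k _; rewrite poly_innerZ // poly_innerC // (poly_inner_basis _ Pc).
  exact: mulrC.
have [Q [PiQ KQ Qrep]] := KK x; rewrite KQ; have [c Qc] := q_span PiQ; rewrite Qc; apply: eq_bigr => k _.
by rewrite -(poly_inner_basis k Qc) poly_innerC // Qrep // expr2.
Qed.

Lemma CD_kernel_diag_le x : S x ->
  \sum_k pval (q k) x ^+ 2 <= sup [set CD_kernel mu d x x | x in S].
Proof.
move=> Sx; rewrite -CD_kernel_diag; apply: sup_upper_bound; last by exists x.
(* The supremum bounds the set only once the set is known to be bounded, which compactness of the
   support provides. *)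
split; first by exists (CD_kernel mu d x x); exists x.
have /choice[M HM] k := (bmfun_supp_pval S_compact (q k)).2.
exists (\sum_k M k ^+ 2) => _ [y Sy <-]; rewrite CD_kernel_diag.
apply: ler_sum => k _; have := HM k y; rewrite /supp_pval indicE mem_set // mulr1 => h.
by rewrite -real_normK ?num_real // lerXn2r ?nnegrE // (le_trans _ h).
Qed.

End kernel_diagonal.

(** * Choice of eps and sum of the two tails *)

Section union_bound.
Context (R : realType).

Lemma max_sqrt_min (c : R) (e := Num.max (Num.sqrt c) c) : 0 < c ->
  0 < e /\ e * Num.min e 1 = c.
Proof.
move=> c0; have s0 : 0 < Num.sqrt c by rewrite sqrtr_gt0.
have ss : Num.sqrt c * Num.sqrt c = c by rewrite -expr2 sqr_sqrtr // ltW.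
split; first by rewrite /e lt_max c0 orbT.
have [s1|s1] := leP (Num.sqrt c) 1.
  have cs : c <= Num.sqrt c by rewrite -[leLHS]ss ler_piMr // ltW.
  by rewrite /e (max_l cs) (min_l s1).
have cs : Num.sqrt c <= c by rewrite -[leRHS]ss ler_peMr // ltW.
by rewrite /e (max_r cs) min_r ?mulr1 // (le_trans (ltW s1)).
Qed.

(** With z = (alpha / s)^(3/4) the two terms are alpha z and alpha z ^ 2. As alpha / s <= 1/2, z ^ 4
    <= 1/8 < (3/5) ^ 4, so z + z ^ 2 <= 24/25. *)
Lemma union_bound_le (s alpha : R) (L := ln (s / alpha)) : 2 <= s -> 0 < alpha < 1 ->
  0 < L /\ s * (expR (- (7 / 4 * L)) + expR (- (5 / 2 * L))) <= alpha.
Proof.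
move=> s2 /andP[a0 a1]; have s0 : 0 < s by lra.
have sa : 0 < s / alpha by rewrite divr_gt0.
have sa2 : 2 <= s / alpha by rewrite ler_pdivlMr //; nra.
split; first by rewrite ln_gt0 //; lra.
have eL : expR L = s / alpha by rewrite lnK.
pose z := expR (- (3 / 4 * L)).
have z0 : 0 < z by exact: expR_gt0.
have E1 : s * expR (- (7 / 4 * L)) = alpha * z.
  rewrite (_ : - (7 / 4 * L) = - L - 3 / 4 * L); last by lra.
  by rewrite expRD expRN eL -/z; field; rewrite !gt_eqF.
have E2 : s * expR (- (5 / 2 * L)) = alpha * z ^+ 2.
  rewrite (_ : - (5 / 2 * L) = - L + 2%:R * - (3 / 4 * L)); last by lra.
  by rewrite expRD expRM_natl expRN eL -/z; field; rewrite !gt_eqF.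
have E4 : z ^+ 4 = (alpha / s) ^+ 3.
  rewrite -expRM_natl (_ : 4%:R * - (3 / 4 * L) = 3%:R * - L); last by field.
  by rewrite expRM_natl expRN eL invf_div.
have h : (alpha / s) ^+ 3 <= 1 / 8.
  rewrite (_ : 1 / 8 = (1 / 2) ^+ 3); last by field.
  have h2 : alpha / s <= 1 / 2 by rewrite ler_pdivrMr //; nra.
  by rewrite lerXn2r ?nnegrE ?divr_ge0 // ltW.
have z6 : z <= 3 / 5.
  rewrite leNgt; apply/negP => z6.
  have : (3 / 5) ^+ 4 < z ^+ 4 by rewrite ltrXn2r ?nnegrE //; lra.
  rewrite E4 => /lt_le_trans /(_ h); rewrite (_ : (3 / 5) ^+ 4 = 81 / 625); last by field.
  lra.
rewrite mulrDr E1 E2 -mulrDr -[leRHS]mulr1 ler_wpM2l ?ltW // expr2.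
nra.
Qed.

End union_bound.

Lemma mean_law (R : realType) (dO dT : measure_display) (Omega : measurableType dO)
    (T : measurableType dT) (Pr : probability Omega R) (X : {RV Pr >-> T})
    (mu : probability T R) (h : T -> R) :
  has_law X mu -> bmfun h -> mean Pr (h \o X) = mean mu h.
Proof.
move=> Xmu bh; have bhX := bmfun_comp (measurable_funPT X) bh.
have mh : measurable_fun setT (EFin \o h) by apply/measurable_EFinP; case: bh.
rewrite /mean /Rintegral; congr fine.
transitivity (\int[distribution Pr X]_y (EFin \o h) y)%E.
  by rewrite integral_distribution //; exact: (bmfun_integrable Pr bhX).
by apply: eq_measure_integral => A mA _; exact: Xmu.
Qed.

Theorem theorem3p10 (R : realType) (p : nat)
    (mu : probability (borelRn R p) R)
    (supp_compact : compact (measure_support mu))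
    (supp_interior : interior (measure_support mu) !=set0)
    (dO : measure_display) (Omega : measurableType dO)
    (Pr : probability Omega R)
    (n : nat) (n_ge1 : (1 <= n)%N)
    (X : 'I_n -> {RV Pr >-> borelRn R p})
    (X_indep : mutually_independent X)
    (X_law : forall i : 'I_n, has_law (X i) mu)
    (d : nat) (alpha : R) (alpha_gt0 : 0 < alpha) :
  let m : R := sup [set CD_kernel mu d x x | x in measure_support mu] in
  let c : R := (16 * m) / (3 * n%:R) * ln ((sdim p d)%:R / alpha) in
  exists E : set Omega,
    [/\ measurable E,
        ((1 - alpha)%:E <= Pr E)%E &
        forall w : Omega, E w -> forall x : 'rV[R]_p,
          `| christoffel mu d x
             - christoffel (empirical_measure R (fun i : 'I_n => X i w)) d x |
          <= christoffel mu d x * Num.max (Num.sqrt c) c].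
Proof.
move=> m c; have nR : 0 < n%:R :> R by rewrite ltr0n.
(* For alpha >= 1 the required probability is nonpositive. *)
have [alpha1|alpha1] := leP 1 alpha.
  exists set0; split=> //; first by rewrite measure0 lee_fin subr_le0.
have [r [q [r_lt Pi_q q_on q_span]]] := orthonormal_basis supp_compact supp_interior d.
pose S := measure_support mu.
have mS : measurable (S : set (borelRn R p)) by exact: support_measurable.
have emp_ge0 w (P : mvpoly R p) :
    0 <= poly_inner (empirical_measure R (fun i : 'I_n => X i w)) P P.
  by rewrite poly_inner_empirical mulr_ge0 ?invr_ge0 // sumr_ge0 // => i _; exact: sqr_ge0.
have mu_ge0 (P : mvpoly R p) : 0 <= poly_inner mu P P by exact: poly_inner_ge0.
have eps_ge0 : 0 <= Num.max (Num.sqrt c) c by rewrite le_max sqrtr_ge0.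
(* In dimension one every polynomial of the space is constant, and the two norms agree for every
   sample. *)
have [s1|s1] := leP (sdim p d) 1.
  exists setT; split=> //.
    by rewrite probability_setT lee_fin gerDl oppr_le0 ltW.
  move=> w _ x; apply: christoffel_compare => // P PiP.
  suff -> : poly_inner (empirical_measure R (fun i : 'I_n => X i w)) P P = poly_inner mu P P.
    by apply/andP; split; have := mu_ge0 P; nra.
  have r0 : r = 0 by apply/eqP; rewrite -leqn0 -ltnS (leq_trans r_lt).
  have r_0 (k : 'I_r.+1) : k = ord0.
    by apply/val_inj; case: k => k /= kr; move: kr; rewrite r0; case: k.
  have [Q PQ Q1] := Pi_one R p d; have [b Qb] := q_span Q PQ; have [a Pa] := q_span P PiP.
  have qb x0 : b ord0 * pval (q ord0) x0 = 1.
    by rewrite -(Q1 x0) Qb (bigD1 ord0) //= big1 ?addr0 // => k; rewrite (r_0 k) eqxx.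
  have P_cst x0 : pval P x0 = a ord0 / b ord0.
    rewrite Pa (bigD1 ord0) //= big1 ?addr0 => [|k]; last by rewrite (r_0 k) eqxx.
    have b0 : b ord0 != 0.
      by apply: contraTneq (oner_neq0 R) => b0; rewrite -(qb x0) b0 mul0r eqxx.
    by rewrite -[LHS]mul1r -(divff b0) -[a ord0 / _]mulr1 -(qb x0); field.
  rewrite poly_inner_empirical /poly_inner; under eq_bigr do rewrite P_cst.
  rewrite (_ : Rintegral _ _ _ = mean mu (fun _ => (a ord0 / b ord0) ^+ 2)); last first.
    by congr mean; apply/funext => y; rewrite P_cst expr2.
  by rewrite mean_cst sumr_const card_ord -[(_ ^+ 2) *+ n]mulr_natl mulKf // gt_eqF.
(* The truncated values satisfy |v|^2 <= m at every point, including off the support. *)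
pose v (x : borelRn R p) : 'rV[R]_r.+1 := \row_k supp_pval mu (q k) x.
have v_bm k : bmfun (fun x => v x 0 k).
  by under eq_fun do rewrite mxE; exact: bmfun_supp_pval.
have m_ge x : S x -> \sum_k pval (q k) x ^+ 2 <= m by exact: CD_kernel_diag_le.
have m_ge0 : 0 <= m.
  have [x /interior_subset /m_ge] := supp_interior; apply: le_trans.
  by apply: sumr_ge0 => k _; exact: sqr_ge0.
have v_le x : bform 1 (v x) (v x) <= m.
  rewrite bform1E; under eq_bigr do rewrite mxE /supp_pval indicE.
  have [Sx|nSx] := pselect (S x).
    rewrite mem_set //; under eq_bigr do rewrite mulr1; exact: m_ge.
  rewrite memNset // big1 // => k _; by rewrite mulr0 expr0n.
have v_iso_mu k l : mean mu (fun x => v x 0 k * v x 0 l) = (k == l)%:R.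
  under eq_fun do rewrite !mxE.
  by rewrite -poly_innerE.
have bvv k l : bmfun (fun x => v x 0 k * v x 0 l) by exact: bmfunM.
have v_iso i k l : mean Pr (fun w => v (X i w) 0 k * v (X i w) 0 l) = (k == l)%:R.
  by rewrite -v_iso_mu -(mean_law (X_law i) (bvv k l)).
(* The square of one coordinate of v has mean 1 and is at most m. *)
have m_ge1 : 1 <= m.
  rewrite -(mean_cst mu m) -[leLHS](v_iso_mu 0 0); apply: le_mean => //.
    exact: bmfun_cst.
  move=> x; apply: le_trans (v_le x); rewrite bform1E (bigD1 0) //= -expr2 lerDl.
  by apply: sumr_ge0 => k _; exact: sqr_ge0.
have alpha01 : 0 < alpha < 1 by rewrite alpha_gt0.
have s2 : 2 <= (sdim p d)%:R :> R by rewrite ler_nat.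
have [L0 union] := union_bound_le s2 alpha01.
have m0 : 0 < m by exact: lt_le_trans m_ge1.
have c0 : 0 < c by rewrite mulr_gt0 // divr_gt0 // mulr_gt0.
have [eps0 epsE] := max_sqrt_min c0.
have [B mB [PB HB]] := gram_concentration X_indep v_bm v_le v_iso n_ge1 m_ge1 eps0 L0 epsE.
(* Almost surely all samples lie in the support, where [v] gives the true values of the basis. *)
pose G := \bigcap_(i in [set` [set: 'I_n]%SET]) (X i @^-1` S).
have mG : measurable G.
  apply: fin_bigcap_measurable => // i _; rewrite -[_ @^-1` _]setTI.
  exact: measurable_funPT.
have PG : Pr G = 1%E.
  rewrite /G X_indep // big1 // => i _.
  transitivity (mu S); first exact: X_law.
  by rewrite -[S]setCK probability_setC ?(support_full mu) ?sube0 //; exact: measurableC.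
exists (G `&` ~` B); split; first by apply: measurableI => //; exact: measurableC.
  have mGB : measurable (~` G `|` B) by apply: measurableU => //; exact: measurableC.
  have PGC : (Pr (~` G) <= 0)%E by rewrite probability_setC // PG subee.
  have PGB : (Pr (~` G `|` B) <= alpha%:E)%E.
    rewrite (le_trans (measureU2 _ _ _)) //; first exact: measurableC.
    rewrite -[leRHS]add0e; apply: leeD; first exact: PGC.
    apply: (le_trans PB); rewrite lee_fin (le_trans _ union) //.
    by rewrite ler_wpM2r ?addr_ge0 ?expR_ge0 // ler_nat.
  rewrite -[G in G `&` _]setCK -setCU probability_setC // EFinB.
  by rewrite leeB.
move=> w [Gw nBw] x.
have Sw i : S (X i w) by apply: Gw; rewrite /= finset.in_setT.
apply: christoffel_compare => // P PiP.
have [a Pa] := q_span P PiP.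
(* In the coordinates of P, the identity form is the squared norm for mu and the Gram sum is n times
   the squared norm for the empirical measure. *)
pose u : 'rV[R]_r.+1 := \row_k a k.
have uu : bform 1 u u = poly_inner mu P P.
  rewrite (poly_inner_parseval supp_compact q_on Pa) bform1E.
  by apply: eq_bigr => k _; rewrite mxE.
have Su : bform (gram_sum X v n w) u u = \sum_i pval P (X i w) ^+ 2.
  rewrite bform_gram_sum; apply: eq_big => [i|i _]; first by rewrite ltn_ord.
  rewrite bform_rank1 (bformC (v _) u) ?trmx1 // -expr2; congr (_ ^+ 2).
  rewrite /bform mulmx1 mxE Pa; apply: eq_bigr => k _.
  by rewrite !mxE /supp_pval indicE (mem_set (Sw i)) mulr1.
have := HB w nBw u; rewrite uu Su poly_inner_empirical => /andP[h1 h2].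
apply/andP; split.
  by rewrite ler_pdivlMl // mulrA.
by rewrite ler_pdivrMl // mulrA.
Qed.
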